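(* There exist a prime $p$ (with a positive power $q$ of $p$), a prime polynomial $\nu\in R_\infty=\mathbb{F}_q[Y]$ and an $A_\infty$-periodic point $x_0\in X_\infty$ such that for every rational $\xi\in\Omega$, the zero measure belongs to $\Theta_\xi$.
   Context: Let $q$ be a positive power of a prime $p$, $K=\mathbb{F}_q(Y)$, $R_\infty=\mathbb{F}_q[Y]$, $K_\infty=\mathbb{F}_q((Y^{-1}))$, and $X_\infty=\mathrm{PGL}_2(K_\infty)/\mathrm{PGL}_2(R_\infty)$. Via $g\,\mathrm{PGL}_2(R_\infty)\mapsto [g(R_\infty\times R_\infty)]$, the space $X_\infty$ is the space of homothety classes (under $K_\infty^\times$) of $R_\infty$-lattices in $K_\infty\times K_\infty$, i.e. rank $2$ free $R_\infty$-submodules spanning $K_\infty\times K_\infty$ over $K_\infty$. Let $A_\infty$ be the diagonal subgroup of $\mathrm{PGL}_2(K_\infty)$, acting on $X_\infty$ on the left. A point $x\in X_\infty$ is $A_\infty$-periodic if its orbit $A_\infty x$ is compact; $\mu_x$ then denotes the unique $A_\infty$-invariant probability measure on $A_\infty x$. For a prime polynomial $\nu\in R_\infty$, let $K_\nu$ be the completion of $K$ at $\nu$ and $O_\nu$ its valuation ring. The Hecke tree $T_\nu(x_0)$ is the connected component of $x_0$ in the graph with vertex set $X_\infty$, with an edge between two classes whenever they have representatives $\Lambda,\Lambda'$ with $\Lambda'\subset\Lambda$ and $\Lambda/\Lambda'\cong R_\infty/\nu R_\infty$ as $R_\infty$-modules. It is a regular tree. Let $\Omega$ be its boundary at infinity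 (set of ends). For $\xi\in\Omega$, $(x_n^\xi)_{n\in\mathbb{N}}$ denotes the sequence of vertices along the geodesic ray in $T_\nu(x_0)$ from $x_0$ to $\xi$. If $x_0$ is $A_\infty$-periodic, all vertices of $T_\nu(x_0)$ are $A_\infty$-periodic. $\Omega$ identifies with $\mathbb{P}^1(K_\nu)$ as follows: choose $g\in \mathrm{GL}_2(K_\infty)$ with $x_0=[g(R_\infty^2)]$; to $[a:b]\in\mathbb{P}^1(K_\nu)$ with $a,b\in O_\nu$ not both in $\nu O_\nu$, associate the end of the ray $n\mapsto [g(L_n)]$, where $L_n=R_\infty^2\cap\big(O_\nu\,(a,b)+\nu^nO_\nu^2\big)$. A point of $\Omega$ is rational if it corresponds to a point of $\mathbb{P}^1(K)$; this does not depend on the choice of $g$. For $\xi\in\Omega$, $\Theta_\xi$ is the set of weak-star accumulation points (tested against continuous functions with compact support) of the sequence of measures $(\mu_{x_n^\xi})_{n\in\mathbb{N}}$ on $X_\infty$. *)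

(* Defs.v *)
From HB Require Import structures.
From mathcomp Require Import all_boot all_order all_algebra.
From mathcomp Require Import all_classical all_reals all_analysis.
From mathcomp Require Import zify ring.

Set Implicit Arguments.
Unset Strict Implicit.
Unset Printing Implicit Defensive.

Import Order.TTheory GRing.Theory Num.Theory.

Local Open Scope classical_set_scope.
Local Open Scope quotient_scope.
Local Open Scope ring_scope.

Import numFieldNormedType.Exports.

(* Formal Laurent series in one variable T: f n is the coefficient of T ^ n.
   The field F((Y^-1)) is [laurent F] with T = Y^-1. *)
Section Laurent.
Variable F : fieldType.

Definition bounded_below (f : int -> F) :=
  exists N : int, forall n : int, n < N -> f n = 0.

Record laurent := Laurent {
  lcoef :> int -> F;
  lcoefP : `[< bounded_below lcoef >] }.

HB.instance Definition _ := [isSub for lcoef].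
HB.instance Definition _ := [Choice of laurent by <:].

Definition mk_laurent (f : int -> F) (bf : bounded_below f) : laurent :=
  Laurent (introT (asboolP _) bf).

Lemma laurent_bounded (f : laurent) : bounded_below f.
Proof. exact/asboolP/lcoefP. Qed.

Lemma laurentP (f g : laurent) : (forall n, f n = g n) -> f = g.
Proof. by move=> fg; apply/val_inj/funext. Qed.

Lemma laurent_zero_subproof : bounded_below (fun=> 0).
Proof. by exists 0. Qed.
Definition laurent_zero := mk_laurent laurent_zero_subproof.

Lemma laurent_one_subproof : bounded_below (fun n => (n == 0)%:R).
Proof. by exists 0 => n; case: eqP => // ->. Qed.
Definition laurent_one := mk_laurent laurent_one_subproof.

Lemma laurent_opp_subproof (f : laurent) : bounded_below (fun n => - f n).
Proof.
by have [N fN] := laurent_bounded f; exists N => n /fN ->; rewrite oppr0.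
Qed.
Definition laurent_opp f := mk_laurent (laurent_opp_subproof f).

Lemma laurent_add_subproof (f g : laurent) :
  bounded_below (fun n => f n + g n).
Proof.
have [N fN] := laurent_bounded f; have [M gM] := laurent_bounded g.
by exists (Num.min N M) => n; rewrite lt_min => /andP[/fN-> /gM->]; rewrite addr0.
Qed.
Definition laurent_add f g := mk_laurent (laurent_add_subproof f g).

Lemma conv_support (f g : laurent) (N M n : int) :
    (forall i, i < N -> f i = 0) -> (forall i, i < M -> g i = 0) ->
  (fun i => f i * g (n - i)) @^-1` [set~ 0] `<=` `[N, n - M]%classic.
Proof.
move=> fN gM i /= nz; rewrite in_itv /= !leNgt; apply/andP; split.
  by apply/negP => /fN fi; apply: nz; rewrite fi mul0r.
apply/negP => lt_i; apply: nz; rewrite (gM (n - i)) ?mulr0 //; lia.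
Qed.

Lemma finite_itv_int (a b : int) : finite_set `[a, b]%classic.
Proof.
apply: (@sub_finite_set _ _ ((fun k : nat => a + k%:Z) @` `I_(`|b - a|.+1)%N)).
  move=> i /=; rewrite in_itv /= => /andP[ai ib].
  exists `|i - a|%N; rewrite ?gez0_abs; lia.
by apply: finite_image; apply: finite_II.
Qed.

Lemma conv_finite (f g : laurent) (n : int) :
  finite_set ((fun i => f i * g (n - i)) @^-1` [set~ 0]).
Proof.
have [N fN] := laurent_bounded f; have [M gM] := laurent_bounded g.
exact: sub_finite_set (conv_support fN gM) (finite_itv_int _ _).
Qed.

Definition laurent_conv (f g : int -> F) (n : int) : F :=
  \sum_(i \in [set: int]) f i * g (n - i).

Lemma laurent_mul_subproof (f g : laurent) : bounded_below (laurent_conv f g).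
Proof.
have [N fN] := laurent_bounded f; have [M gM] := laurent_bounded g.
exists (N + M) => n nNM; rewrite /laurent_conv fsbig1 // => i _.
have [/fN ->|iN] := ltP i N; first by rewrite mul0r.
by rewrite gM ?mulr0 //; lia.
Qed.
Definition laurent_mul f g := mk_laurent (laurent_mul_subproof f g).

Fact laurent_addA : associative laurent_add.
Proof. by move=> f g h; apply: laurentP => n /=; rewrite addrA. Qed.
Fact laurent_addC : commutative laurent_add.
Proof. by move=> f g; apply: laurentP => n /=; rewrite addrC. Qed.
Fact laurent_add0 : left_id laurent_zero laurent_add.
Proof. by move=> f; apply: laurentP => n /=; rewrite add0r. Qed.
Fact laurent_addN : left_inverse laurent_zero laurent_opp laurent_add.
Proof. by move=> f; apply: laurentP => n /=; rewrite addNr. Qed.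

HB.instance Definition _ := GRing.isZmodule.Build laurent
  laurent_addA laurent_addC laurent_add0 laurent_addN.

Fact conv_itv (f g : laurent) (a b n : int) :
    (forall i, i < a -> f i = 0) -> (forall i, b < i -> g (n - i) = 0) ->
  laurent_conv f g n = \sum_(i \in `[a, b]%classic) f i * g (n - i).
Proof.
move=> fa gb; apply/esym/fsbig_widen => // i [_ /=]; rewrite in_itv/= => /negP.
rewrite negb_and -!ltNge => /orP[/fa ->|/gb ->]; by rewrite ?mul0r ?mulr0.
Qed.

Fact laurent_mulC : commutative laurent_mul.
Proof.
move=> f g; apply: laurentP => n /=; rewrite /laurent_conv.
rewrite (reindex_fsbigT (fun i => n - i)) /=; last first.
  by exists (fun i => n - i) => i; rewrite subKr.
by apply: eq_fsbigr => i _; rewrite subKr mulrC.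
Qed.

Fact conv_shift (f g : laurent) (i n : int) :
  laurent_conv f g (n - i) = \sum_(k \in [set: int]) f (k - i) * g (n - k).
Proof.
rewrite /laurent_conv [RHS](reindex_fsbigT (fun k => k + i)) /=; last first.
  by exists (fun k => k - i) => k; rewrite ?addrK ?subrK.
by apply: eq_fsbigr => k _; rewrite addrK; congr (f k * lcoef g _); lia.
Qed.

Fact laurent_mulA : associative laurent_mul.
Proof.
move=> f g h; apply: laurentP => n /=.
have [N fN] := laurent_bounded f; have [M gM] := laurent_bounded g.
have [P hP] := laurent_bounded h.
have ghMP i : i < M + P -> laurent_conv g h i = 0.
  move=> lt_i; rewrite /laurent_conv fsbig1 // => j _.
  have [/gM ->|Mj] := ltP j M; first by rewrite mul0r.
  by rewrite hP ?mulr0 //; lia.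
have fgNM i : i < N + M -> laurent_conv f g i = 0.
  move=> lt_i; rewrite /laurent_conv fsbig1 // => j _.
  have [/fN ->|Mj] := ltP j N; first by rewrite mul0r.
  by rewrite gM ?mulr0 //; lia.
rewrite (@conv_itv f (laurent_mul g h) N (n - (M + P))) //=; last first.
  by move=> i lt_i; apply: ghMP; lia.
rewrite (@conv_itv (laurent_mul f g) h (N + M) (n - P)) //=; last first.
  by move=> i lt_i; apply: hP; lia.
transitivity (\sum_(i \in `[N, n - (M + P)]%classic)
  \sum_(k \in `[N + M, n - P]%classic) f i * (g (k - i) * h (n - k))).
  apply: eq_fsbigr => i; rewrite inE /= in_itv/= => /andP[Ni in_].
  rewrite -mulr_fsumr conv_shift; congr (_ * _).
  apply/esym/fsbig_widen => // k [_ /=]; rewrite in_itv/= => /negP.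
  rewrite negb_and -!ltNge => /orP[lt_k|lt_k].
    by rewrite gM ?mul0r //; lia.
  by rewrite hP ?mulr0 //; lia.
rewrite exchange_fsbig; [|exact: finite_itv_int..].
apply: eq_fsbigr => k; rewrite inE /= in_itv/= => /andP[Nk kn].
rewrite (@conv_itv f g N (n - (M + P))) //; last first.
  by move=> i lt_i; apply: gM; lia.
by rewrite mulr_fsuml; apply: eq_fsbigr => i _; rewrite mulrA.
Qed.

Fact laurent_mul1 : left_id laurent_one laurent_mul.
Proof.
move=> f; apply: laurentP => n /=; rewrite /laurent_conv.
rewrite -(fsbig_widen [set (0 : int)]) //; last first.
  by move=> i [_ /= /eqP/negPf i0]; rewrite i0 mul0r.
by rewrite fsbig_set1 eqxx mul1r subr0.
Qed.

Fact laurent_mulDl : left_distributive laurent_mul laurent_add.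
Proof.
move=> f g h; apply: laurentP => n /=.
have [N fN] := laurent_bounded f; have [M gM] := laurent_bounded g.
have [P hP] := laurent_bounded h.
pose a := Num.min N M.
have hb i : n - P < i -> h (n - i) = 0 by move=> lt_i; apply: hP; lia.
rewrite (@conv_itv (laurent_add f g) h a (n - P)) //=; last first.
  by move=> i; rewrite lt_min => /andP[/fN-> /gM->]; rewrite addr0.
rewrite (@conv_itv f h a (n - P)) //; last first.
  by move=> i; rewrite lt_min => /andP[/fN-> _].
rewrite (@conv_itv g h a (n - P)) //; last first.
  by move=> i; rewrite lt_min => /andP[_ /gM->].
rewrite -fsbig_split; last exact: finite_itv_int.
by apply: eq_fsbigr => i _; rewrite mulrDl.
Qed.

Fact laurent_one_neq0 : laurent_one != 0.
Proof.
apply/eqP => /(congr1 (fun f : laurent => f 0)) /= /eqP.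
by rewrite oner_eq0.
Qed.

HB.instance Definition _ := GRing.Zmodule_isComNzRing.Build laurent
  laurent_mulA laurent_mulC laurent_mul1 laurent_mulDl laurent_one_neq0.

Fixpoint inv_seq (u : nat -> F) (n : nat) : seq F :=
  if n is m.+1 then
    let s := inv_seq u m in
    rcons s ((u 0%N)^-1 *
      ((m == 0%N)%:R - \sum_(k < m) u (m - k)%N * s`_k))
  else [::].

Lemma size_inv_seq u n : size (inv_seq u n) = n.
Proof. by elim: n => //= n IH; rewrite size_rcons IH. Qed.

Lemma nth_inv_seq u n m : (n < m)%N ->
  (inv_seq u m)`_n = (inv_seq u n.+1)`_n.
Proof.
elim: m => // m IH; rewrite ltnS leq_eqVlt => /predU1P[->//|nm].
by rewrite -IH //= nth_rcons size_inv_seq nm.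
Qed.

Lemma inv_seqP u n : u 0%N != 0 ->
  \sum_(k < n.+1) u (n - k)%N * (inv_seq u k.+1)`_k = (n == 0%N)%:R.
Proof.
move=> u0; rewrite big_ord_recr /= subnn nth_rcons size_inv_seq ltnn eqxx.
rewrite mulVKf // addrC -[RHS](subrK (\sum_(k < n) u (n - k)%N * (inv_seq u n)`_k)).
congr (_ + _); apply: eq_bigr => k _.
by rewrite [in RHS]nth_inv_seq.
Qed.

Lemma laurent_lead (f : laurent) : f != 0 ->
  exists v : int, f v != 0 /\ forall n, n < v -> f n = 0.
Proof.
move=> f0; have [N fN] := laurent_bounded f.
have ex : exists k : nat, f (N + k%:Z) != 0.
  apply: contrapT => /forallNP nz; move/eqP: f0; apply; apply: laurentP => n /=.
  have [/fN //|Nn] := ltP n N.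
  have /negP := nz `|n - N|%N; rewrite negbK.
  by rewrite (_ : N + _ = n) => [/eqP//|]; lia.
exists (N + (ex_minn ex)%:Z); case: ex_minnP => k fk kmin; split=> // n lt_n.
have [/fN //|Nn] := ltP n N.
have e : n = N + `|n - N|%N%:Z by lia.
apply/eqP/negPn/negP; rewrite e => /kmin; lia.
Qed.

Lemma laurent_inv_ex (f : laurent) : f != 0 -> exists g : laurent, g * f = 1.
Proof.
move=> /laurent_lead [v [fv0 fv]].
pose u k := f (v + k%:Z).
have u0 : u 0%N != 0 by rewrite /u addr0.
pose g (n : int) : F :=
  if 0 <= n + v then (inv_seq u `|n + v|.+1)`_(`|n + v|) else 0.
have bg : bounded_below g.
  by exists (- v) => n lt_n; rewrite /g ifF //; apply/negbTE; rewrite -ltNge; lia.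
exists (mk_laurent bg); apply: laurentP => n /=.
have gv i : i < - v -> mk_laurent bg i = 0.
  by move=> lt_i; rewrite /= /g ifF //; apply/negbTE; rewrite -ltNge; lia.
rewrite (@conv_itv (mk_laurent bg) f (- v) (n - v)) //; last first.
  by move=> i lt_i; apply: fv; lia.
case: (ltP n 0) => [n0|n0].
  rewrite fsbig1 /=; first by rewrite lt_eqF.
  by move=> i /=; rewrite in_itv /=; lia.
case: n n0 => // n _.
rewrite (@reindex_fsbig _ _ _ _ _ (fun k : nat => - v + k%:Z) `I_n.+1); last first.
  split.
  - by move=> k /= kn; rewrite in_itv /=; lia.
  - by move=> i j _ _ /addrI [].
  - move=> i /=; rewrite in_itv /= => iv; exists (absz (i + v : int)); lia.
rewrite -fsbig_ord -[RHS](@inv_seqP u n u0); apply: eq_bigr => k _.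
rewrite /= /g addrAC addNr add0r /= mulrC; congr (_ * _).
rewrite /u; congr (lcoef f _).
by have := ltn_ord k; move: (nat_of_ord k) => j; lia.
Qed.

Definition laurent_inv (f : laurent) : laurent :=
  if f == 0 then 0 else xget 0 [set g | g * f = 1].

Fact laurent_mulVf f : f != 0 -> laurent_inv f * f = 1.
Proof.
move=> f0; rewrite /laurent_inv (negPf f0).
have [g gf] := laurent_inv_ex f0.
by case: xgetP => [h -> //|/(_ g)].
Qed.

Fact laurent_inv0 : laurent_inv 0 = 0.
Proof. by rewrite /laurent_inv eqxx. Qed.

HB.instance Definition _ := GRing.ComNzRing_isField.Build laurent
  laurent_mulVf laurent_inv0.

(* The topology is the T-adic one. *)
Definition laurent_ball (N : int) : set (laurent * laurent) :=
  [set fg : laurent * laurent | forall n : int, n < N -> fg.1 n = fg.2 n].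

Definition laurent_ent : set_system (laurent * laurent) :=
  filter_from setT laurent_ball.

Fact laurent_ent_filter : Filter laurent_ent.
Proof.
apply: filter_from_filter; first by exists 0.
move=> N M _ _; exists (Num.max N M) => // fg /= H.
by split=> n lt_n; apply: H; rewrite lt_max lt_n ?orbT.
Qed.

Local Open Scope relation_scope.
Fact laurent_ent_refl A : laurent_ent A -> diagonal `<=` A.
Proof. by move=> [N _ NA] fg fgE; apply: NA => n _; rewrite fgE. Qed.

Fact laurent_ent_inv A : laurent_ent A -> laurent_ent A^-1.
Proof. by move=> [N _ NA]; exists N => // fg /= H; apply: NA => n /H ->. Qed.

Fact laurent_ent_split A :
  laurent_ent A -> exists2 B, laurent_ent B & B \; B `<=` A.
Proof.
move=> [N _ NA]; exists (laurent_ball N); first by exists N.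
by move=> [f g] [h /= fh hg]; apply: NA => n nN /=; rewrite fh // hg.
Qed.

HB.instance Definition _ := isUniform.Build laurent
  laurent_ent_filter laurent_ent_refl laurent_ent_inv laurent_ent_split.

End Laurent.


(* Discrete valuations; the value at 0 is unspecified, and is read as +oo by
   [vge] below. *)
Record valuation (K : fieldType) := Valuation {
  vfun :> K -> int;
  vfunM : forall x y, x != 0 -> y != 0 -> vfun (x * y) = vfun x + vfun y;
  vfunD : forall x y, x != 0 -> y != 0 -> x + y != 0 ->
    Num.min (vfun x) (vfun y) <= vfun (x + y) }.

Section Completion.
Variables (K : fieldType) (v : valuation K).
Implicit Types (x y : K) (m n : int).

Definition vge n x : bool := (x == 0) || (n <= v x).

Lemma vge0 n : vge n 0. Proof. by rewrite /vge eqxx. Qed.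

Lemma vfun1 : v 1 = 0.
Proof. by apply: (addrI (v 1)); rewrite -vfunM ?oner_neq0 // mulr1 addr0. Qed.

Lemma vge1 : vge 0 1. Proof. by rewrite /vge vfun1 lexx orbT. Qed.

Lemma vgeM m n x y : vge m x -> vge n y -> vge (m + n) (x * y).
Proof.
rewrite /vge mulf_eq0; have [->//|x0] := eqVneq x 0.
have [->|y0] /= := eqVneq y 0; first by rewrite ?orbT.
by rewrite vfunM //; lia.
Qed.

Lemma vgeN n x : vge n (- x) = vge n x.
Proof.
rewrite /vge oppr_eq0; have [//|x0] := eqVneq x 0.
have N1 : -1 != 0 :> K by rewrite oppr_eq0 oner_eq0.
have := vfunM v N1 N1; rewrite mulrNN mulr1 vfun1 => vN1.
by rewrite -mulN1r vfunM //; lia.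
Qed.

Lemma vgeD n x y : vge n x -> vge n y -> vge n (x + y).
Proof.
rewrite /vge; have [->|x0] /= := eqVneq x 0; first by rewrite add0r.
have [->|y0] /= := eqVneq y 0; first by rewrite addr0 (negPf x0).
have [//|xy0] /= := eqVneq (x + y) 0 => nx ny.
by apply: le_trans _ (vfunD v x0 y0 xy0); rewrite le_min nx.
Qed.

Lemma vgeB n x y : vge n x -> vge n y -> vge n (x - y).
Proof. by move=> nx ny; apply: vgeD; rewrite ?vgeN. Qed.

Lemma vgeBC n x y : vge n (x - y) = vge n (y - x).
Proof. by rewrite -vgeN opprB. Qed.

Lemma vge_le m n x : m <= n -> vge n x -> vge m x.
Proof. by rewrite /vge => mn /orP[->//|/(le_trans mn) ->]; rewrite orbT. Qed.

Definition is_cauchy_seq (s : nat -> K) := forall n, exists N : nat,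
  forall i j : nat, (N <= i)%N -> (N <= j)%N -> vge n (s i - s j).

Definition is_null (s : nat -> K) := forall n, exists N : nat,
  forall i : nat, (N <= i)%N -> vge n (s i).

Lemma cauchy_bounded s : is_cauchy_seq s -> exists m, exists N : nat,
  forall i : nat, (N <= i)%N -> vge m (s i).
Proof.
move=> /(_ 0) [N sN]; exists (Num.min 0 (v (s N))), N => i Ni.
rewrite -(subrK (s N) (s i)); apply: vgeD.
  by apply: (@vge_le _ 0); [lia | exact: sN].
by rewrite /vge; apply/orP; right; lia.
Qed.

Lemma cst_cauchy x : is_cauchy_seq (fun=> x).
Proof. by move=> n; exists 0%N => i j _ _; rewrite subrr vge0. Qed.

Lemma cauchyB s t : is_cauchy_seq s -> is_cauchy_seq t -> is_cauchy_seq (fun i => s i - t i).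
Proof.
move=> cs ct n; have [N sN] := cs n; have [M tM] := ct n.
exists (maxn N M) => i j; rewrite !geq_max => /andP[Ni Mi] /andP[Nj Mj].
rewrite (_ : _ - _ = (s i - s j) - (t i - t j)); last by ring.
by apply: vgeB; [exact: sN | exact: tM].
Qed.

Lemma cauchyM s t : is_cauchy_seq s -> is_cauchy_seq t -> is_cauchy_seq (fun i => s i * t i).
Proof.
move=> cs ct n; have [a [A sA]] := cauchy_bounded cs.
have [b [B tB]] := cauchy_bounded ct.
have [N sN] := cs (n - b); have [M tM] := ct (n - a).
exists (maxn (maxn A B) (maxn N M)) => i j.
rewrite !geq_max => /andP[/andP[Ai Bi] /andP[Ni Mi]].
move=> /andP[/andP[Aj Bj] /andP[Nj Mj]].
rewrite (_ : _ - _ = s i * (t i - t j) + (s i - s j) * t j); last by ring.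
apply: vgeD.
  by rewrite -(subrKC a n); apply: vgeM; [exact: sA | exact: tM].
by rewrite -(subrK b n); apply: vgeM; [exact: sN | exact: tB].
Qed.

Record cauchy_seq := Cauchy {
  cseq :> nat -> K;
  cseqP : `[< is_cauchy_seq cseq >] }.

HB.instance Definition _ := [isSub for cseq].
HB.instance Definition _ := [Choice of cauchy_seq by <:].

Fact cauchy_seq_subring_closed :
  subring_closed (fun s : nat -> K => `[< is_cauchy_seq s >]).
Proof.
split; first exact/asboolP/cst_cauchy.
- by move=> s t /asboolP cs /asboolP ct; apply/asboolP/cauchyB.
- by move=> s t /asboolP cs /asboolP ct; apply/asboolP/cauchyM.
Qed.

HB.instance Definition _ := GRing.SubChoice_isSubComNzRing.Build (nat -> K)
  (fun s : nat -> K => `[< is_cauchy_seq s >]) cauchy_seq cauchy_seq_subring_closed.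

Definition null_ideal (s : cauchy_seq) : bool := `[< is_null s >].

Fact null_idealr_closed : idealr_closed null_ideal.
Proof.
split.
- by apply/asboolP => n; exists 0%N => i _; rewrite vge0.
- apply/negP => /asboolP /(_ 1) [N /(_ N (leqnn N))].
  by rewrite /vge /= oner_eq0 vfun1.
- move=> a s t /asboolP s0 /asboolP t0; apply/asboolP => n.
  have [b [B aB]] := cauchy_bounded (asboolW (cseqP a)).
  have [N sN] := s0 (n - b); have [M tM] := t0 n.
  exists (maxn B (maxn N M)) => i; rewrite !geq_max => /andP[Bi /andP[Ni Mi]].
  apply: vgeD; last exact: tM.
  by rewrite -(subrKC b n); apply: vgeM; [exact: aB | exact: sN].
Qed.

HB.instance Definition _ :=
  isIdealr.Build cauchy_seq null_ideal null_idealr_closed.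


(* The completion of K for v: Cauchy sequences modulo null sequences. *)
Definition completion := {ideal_quot (null_ideal : idealr cauchy_seq)}.

Local Notation Q := {ideal_quot (null_ideal : idealr cauchy_seq)}.
HB.instance Definition _ := GRing.ComNzRing.on completion.
HB.instance Definition _ := Quotient.on completion.

Lemma cauchy_nonnull (s : cauchy_seq) : ~ is_null s -> exists n, exists N : nat,
  forall i : nat, (N <= i)%N -> ~~ vge n (s i).
Proof.
move=> /existsNP [n /forallNP nn]; exists n.
have [N sN] := asboolW (cseqP s) n; exists N => i Ni.
apply/negP => si; apply: (nn N) => j Nj.
by rewrite -(subrK (s i) (s j)); apply: vgeD => //; exact: sN.
Qed.


Lemma completion_inv_ex (z : Q) : z != 0 -> exists w : Q, w * z = 1.
Proof.
elim/quotW: z => s s0.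
have /cauchy_nonnull [n [N sN]] : ~ is_null s.
  move=> s_null; case/negP: s0; rewrite piE Quotient.equivE subr0.
  exact/asboolP.
pose t i := (s i)^-1.
have si0 i : (N <= i)%N -> s i != 0.
  by move=> /sN; apply: contraNneq => ->; rewrite vge0.
have tN i : (N <= i)%N -> vge (- n) (t i).
  move=> Ni; have := sN i Ni; rewrite /vge invr_eq0 (negPf (si0 i Ni)) /= -ltNge.
  have : v (s i) + v (t i) = 0.
    by rewrite -vfunM ?invr_eq0 ?si0 // divff ?vfun1 ?si0.
  by move: (v (s i)) (v (t i)) => a b; lia.
have ct : is_cauchy_seq t.
  move=> m; have [M sM] := asboolW (cseqP s) (m + n + n).
  exists (maxn N M) => i j; rewrite !geq_max => /andP[Ni Mi] /andP[Nj Mj].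
  rewrite (_ : t i - t j = (s j - s i) * (t i * t j)); last first.
    by rewrite mulrBl mulrCA /t mulfV ?si0 // mulr1 mulrA mulfV ?si0 // mul1r.
  rewrite (_ : m = (m + n + n) + (- n + - n)); last by lia.
  by apply: vgeM; [exact: sM | apply: vgeM; exact: tN].
exists (\pi_Q (Cauchy (introT (asboolP _) ct))).
apply/eqP; rewrite piE Quotient.equivE.
apply/asboolP => m; exists N => i Ni.
rewrite -[cseq _ i]/(t i * s i - 1 : K).
suff -> : t i * s i - 1 = 0 :> K by exact: vge0.
by rewrite /t mulVf ?si0 // subrr.
Qed.

Definition completion_inv (z : completion) : completion :=
  if z == 0 then 0 else xget 0 [set w | w * z = 1].

Fact completion_mulVf (z : completion) : z != 0 -> completion_inv z * z = 1.
Proof.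
move=> z0; rewrite /completion_inv (negPf z0).
have [w wz] := completion_inv_ex z0.
by case: xgetP => [h -> //|/(_ w)].
Qed.

Fact completion_inv0 : completion_inv 0 = 0.
Proof. by rewrite /completion_inv eqxx. Qed.

HB.instance Definition _ := GRing.ComNzRing_isField.Build completion
  completion_mulVf completion_inv0.

Definition cauchy_cst (x : K) : cauchy_seq := Cauchy (introT (asboolP _) (cst_cauchy x)).

Definition to_completion (x : K) : completion := \pi_Q (cauchy_cst x).

(* The valuation ring of the completion: as the valuation of a non-null Cauchy
   sequence is eventually constant, one may test it on eventual terms. *)
Definition completion_ring : set completion :=
  [set z | exists2 s : cauchy_seq, z = \pi_Q s &
     exists N : nat, forall i, (N <= i)%N -> vge 0 (s i)].

Fact to_completion_zmod_morphism : zmod_morphism to_completion.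
Proof.
move=> x y; rewrite /to_completion -[LHS]/(\pi_Q _) -[RHS]/(\pi_Q _ - \pi_Q _).
rewrite -rmorphB; congr (\pi_Q _); exact/val_inj.
Qed.

Fact to_completion_monoid_morphism : monoid_morphism to_completion.
Proof.
split.
  rewrite /to_completion -[RHS]/(1 : Q) -(rmorph1 \pi_Q); congr (\pi_Q _); exact/val_inj.
move=> x y; rewrite /to_completion -[LHS]/(\pi_Q _) -[RHS]/(\pi_Q _ * \pi_Q _).
rewrite -rmorphM; congr (\pi_Q _); exact/val_inj.
Qed.

HB.instance Definition _ := GRing.isZmodMorphism.Build K completion
  to_completion to_completion_zmod_morphism.
HB.instance Definition _ := GRing.isMonoidMorphism.Build K completion
  to_completion to_completion_monoid_morphism.

End Completion.

Section NuAdic.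
Variables (F : fieldType).

Record prime_poly := PrimePoly {
  pval :> {poly F};
  prime_polyP : irreducible_poly pval }.

Variable nu : prime_poly.
Implicit Types p q : {poly F}.

Definition nu_ord p : nat := (\max_(k < size p | ((nu : {poly F}) ^+ k %| p)%R) k)%N.

(* (frac (repr x)).1 and (frac (repr x)).2 are the numerator and the
   denominator of the fraction representing x. *)
Definition nu_val (x : {fraction {poly F}}) : int :=
  (nu_ord (frac (repr x)).1)%:Z - (nu_ord (frac (repr x)).2)%:Z.

Let nu1 : (1 < size (nu : {poly F}))%N. Proof. by case: (prime_polyP nu). Qed.

Lemma ord_dvd p k : p != 0 -> ((nu : {poly F}) ^+ k %| p) = (k <= nu_ord p)%N.
Proof.
move=> p0; have lt_size m : (nu : {poly F}) ^+ m %| p -> (m < size p)%N.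
  move=> /(dvdp_leq p0); apply: leq_trans.
  have : (nu : {poly F}) ^+ m != 0 by rewrite expf_neq0 // (irredp_neq0 (prime_polyP nu)).
  rewrite -size_poly_gt0 => s0; have := size_exp (nu : {poly F}) m.
  by have := nu1; move: (size _) (size _) s0 => a b; nia.
apply/idP/idP => [kp|].
  exact: (@leq_bigmax_cond _ _ (fun k : 'I_(size p) => nat_of_ord k)
    (Ordinal (lt_size k kp)) kp).
have s0 : (0 < size p)%N by rewrite size_poly_gt0.
suff op : (nu : {poly F}) ^+ nu_ord p %| p.
  by move=> kp; apply: dvdp_trans op; exact: dvdp_exp2l.
rewrite /nu_ord; apply: (big_ind (fun m => (nu : {poly F}) ^+ m %| p)) => //.
  by rewrite expr0 dvd1p.
by move=> a b ap bp; rewrite /maxn; case: ifP.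
Qed.

Lemma ordP p : p != 0 ->
  exists2 r, ~~ ((nu : {poly F}) %| r) & p = (nu : {poly F}) ^+ nu_ord p * r.
Proof.
move=> p0; have := ord_dvd (nu_ord p) p0; rewrite leqnn => /dvdpP [r pr].
exists r; last by rewrite mulrC.
apply/negP => /dvdpP [r' rr']; suff: (nu : {poly F}) ^+ (nu_ord p).+1 %| p by rewrite ord_dvd // ltnn.
by rewrite [X in _ %| X]pr rr' -mulrA -exprS dvdp_mull.
Qed.

Lemma prime_poly_neq0 : (nu : {poly F}) != 0.
Proof. exact: irredp_neq0 (prime_polyP nu). Qed.

Lemma prime_poly_dvdM p q :
  (nu : {poly F}) %| p * q -> ((nu : {poly F}) %| p) || ((nu : {poly F}) %| q).
Proof.
have [//|np /=] := boolP ((nu : {poly F}) %| p).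
rewrite Gauss_dvdpr // -gcdp_eqp1 -size_poly_eq1; apply/negPn/negP => szg.
case/negP: np; have := apply_irredp (prime_polyP nu) szg (dvdp_gcdl _ _).
by move=> /eqp_dvdl <-; exact: dvdp_gcdr.
Qed.

Lemma ordE p r k : ~~ ((nu : {poly F}) %| r) ->
  p = (nu : {poly F}) ^+ k * r -> nu_ord p = k.
Proof.
move=> nr pE; have r0 : r != 0 by apply: contraNneq nr => ->; rewrite dvdp0.
have p0 : p != 0 by rewrite pE mulf_neq0 // expf_neq0 // prime_poly_neq0.
apply/eqP; rewrite eqn_leq -(ord_dvd k p0) {2}pE dvdp_mulIl andbT.
rewrite leqNgt -(ord_dvd _ p0); apply: contra nr.
by rewrite pE exprSr dvdp_mul2l // expf_neq0 // prime_poly_neq0.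
Qed.

Lemma ordM p q : p != 0 -> q != 0 -> nu_ord (p * q) = (nu_ord p + nu_ord q)%N.
Proof.
move=> p0 q0; have [r nr pE] := ordP p0; have [s ns qE] := ordP q0.
apply: (@ordE _ (r * s)).
  by apply/negP => /prime_poly_dvdM; rewrite (negPf nr) (negPf ns).
by rewrite {1}pE {1}qE exprD mulrACA.
Qed.

Lemma ordD p q : p != 0 -> q != 0 -> p + q != 0 ->
  (minn (nu_ord p) (nu_ord q) <= nu_ord (p + q))%N.
Proof.
move=> p0 q0 pq0; rewrite -(ord_dvd _ pq0).
by rewrite dvdp_add // ord_dvd // (geq_minl, geq_minr).
Qed.

Local Notation "p %:F" := (@FracField.tofrac {poly F} p).

Lemma ratioE (r : {ratio {poly F}}) :
  \pi_{fraction {poly F}} r * (frac r).2%:F = (frac r).1%:F :> {fraction {poly F}}.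
Proof.
unlock FracField.tofrac; rewrite -[LHS]FracField.pi_mul.
apply/eqmodP; rewrite /= FracField.equivfE /FracField.mulf.
have d0 := denom_ratioP r.
by rewrite !numden_Ratio ?mulf_neq0 ?oner_eq0 // !mulr1 mulrC.
Qed.

Lemma fraction_num (x : {fraction {poly F}}) : x != 0 ->
  exists p q, [/\ p != 0, q != 0, x = p%:F / q%:F &
                  nu_val x = (nu_ord p)%:Z - (nu_ord q)%:Z].
Proof.
move=> x0; have q0 := denom_ratioP (repr x).
have := ratioE (repr x); rewrite reprK => xE.
have xE' : x = (frac (repr x)).1%:F / (frac (repr x)).2%:F.
  have d0 : (frac (repr x)).2%:F != 0 by rewrite tofrac_eq0.
  exact: (canRL (mulfK d0) xE).
exists (frac (repr x)).1, (frac (repr x)).2; split=> //.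
by apply: contraNneq x0 => n0; rewrite xE' n0 rmorph0 mul0r.
Qed.

Lemma nu_valE p q : p != 0 -> q != 0 ->
  nu_val (p%:F / q%:F) = (nu_ord p)%:Z - (nu_ord q)%:Z.
Proof.
move=> p0 q0; set x := p%:F / q%:F.
have x0 : x != 0 by rewrite mulf_neq0 ?invr_eq0 ?tofrac_eq0.
have [a [b [a0 b0 xE ->]]] := fraction_num x0.
have /eqP : p%:F * b%:F == a%:F * q%:F.
  by rewrite -eqr_div ?tofrac_eq0 //; apply/eqP.
rewrite -!rmorphM => /eqP; rewrite tofrac_eq => /eqP /(congr1 nu_ord).
rewrite !ordM // => e; lia.
Qed.

Fact nu_valM x y : x != 0 -> y != 0 -> nu_val (x * y) = nu_val x + nu_val y.
Proof.
move=> /fraction_num [p [q [p0 q0 xE ->]]] /fraction_num [a [b [a0 b0 yE ->]]].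
rewrite xE yE mulf_div -!rmorphM nu_valE ?mulf_neq0 // !ordM //; lia.
Qed.

Fact nu_valD x y : x != 0 -> y != 0 -> x + y != 0 ->
  Num.min (nu_val x) (nu_val y) <= nu_val (x + y).
Proof.
move=> /fraction_num [p [q [p0 q0 xE ->]]] /fraction_num [a [b [a0 b0 yE ->]]].
rewrite xE yE addf_div ?tofrac_eq0 // -!rmorphM -rmorphD => xy0.
have n0 : p * b + a * q != 0.
  by apply: contraNneq xy0 => ->; rewrite rmorph0 mul0r.
have h : (minn (nu_ord p + nu_ord b) (nu_ord a + nu_ord q) <= nu_ord (p * b + a * q))%N.
  by rewrite -!ordM //; apply: ordD; rewrite ?mulf_neq0.
have e : nu_val ((p * b + a * q)%:F / (q * b)%:F) =
    (nu_ord (p * b + a * q))%:Z - (nu_ord q + nu_ord b)%:Z.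
  by rewrite nu_valE ?mulf_neq0 // ordM.
rewrite [nu_val _]e; move: (nu_ord (p * b + a * q)) h => N.
by move: (nu_ord p) (nu_ord q) (nu_ord a) (nu_ord b) => P Q A B; lia.
Qed.

Definition nu_valuation : valuation {fraction {poly F}} :=
  Valuation nu_valM nu_valD.

End NuAdic.

Section PolyLaurent.
Variable F : fieldType.

Fact poly_laurent_subproof (p : {poly F}) :
  bounded_below (fun n : int => if n <= 0 then p`_(absz n) else 0).
Proof.
exists (- (size p)%:Z) => n n_lt; case: ifP => // _.
by apply: nth_default; move: (size p) n_lt => s; lia.
Qed.
(* The polynomial sum_k p_k Y^k is the series sum_k p_k T^(- k), T = Y^-1. *)
Definition poly_laurent (p : {poly F}) : laurent F :=
  mk_laurent (poly_laurent_subproof p).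

Fact poly_laurent_zmod_morphism : zmod_morphism poly_laurent.
Proof.
by move=> p q; apply: laurentP => n /=; case: ifP; rewrite ?coefB ?subr0.
Qed.

Fact poly_laurent_monoid_morphism : monoid_morphism poly_laurent.
Proof.
split.
  apply: laurentP => n /=; rewrite coef1; case: ifP => n0.
    by rewrite absz_eq0.
  by case: eqP n0 => // ->.
move=> p q; apply: laurentP => n /=; rewrite /laurent_conv.
rewrite -(fsbig_widen `[n, 0]%classic) //; last first.
  move=> i [_ /=]; rewrite in_itv/= => /negP; rewrite negb_and -!ltNge => /orP[ni|ni].
    by rewrite [X in _ * X]ifF ?mulr0 //; apply/negbTE; rewrite -ltNge; lia.
  by rewrite ifF ?mul0r //; apply/negbTE; rewrite -ltNge.
case: ifP => n0; last first.
  by rewrite fsbig1 // => i /=; rewrite in_itv /=; lia.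
have [m ->] : exists m : nat, n = - m%:Z by exists (absz n); lia.
rewrite (@reindex_fsbig _ _ _ _ _ (fun k : nat => - k%:Z) `I_m.+1); last first.
  split.
  - by move=> k /= kn; rewrite in_itv /=; lia.
  - by move=> i j _ _ /oppr_inj [].
  - move=> i /=; rewrite in_itv /= => iv; exists (absz (i : int)); lia.
rewrite -fsbig_ord abszN absz_nat coefM; apply: eq_bigr => k _.
have := ltn_ord k; move: (nat_of_ord k) => j jm.
rewrite !ifT; [|lia..]; congr (p`_ _ * q`_ _); lia.
Qed.

HB.instance Definition _ := GRing.isZmodMorphism.Build {poly F} (laurent F)
  poly_laurent poly_laurent_zmod_morphism.
HB.instance Definition _ := GRing.isMonoidMorphism.Build {poly F} (laurent F)
  poly_laurent poly_laurent_monoid_morphism.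
End PolyLaurent.

Section CosetSpace.
Variable G : groupType.
Local Open Scope group_scope.

Record subgroup := Subgroup {
  subgroup_set :> set G;
  subgroup1 : subgroup_set 1;
  subgroupM : forall x y, subgroup_set x -> subgroup_set y -> subgroup_set (x * y);
  subgroupV : forall x, subgroup_set x -> subgroup_set x^-1 }.

Variable H : subgroup.

(* The classes of this relation are the left cosets x H. *)
Definition coset_rel (x y : G) : bool := `[< subgroup_set H (x^-1 * y) >].

Fact coset_rel_refl : reflexive coset_rel.
Proof. by move=> x; apply/asboolP; rewrite mulVg; exact: subgroup1. Qed.

Fact coset_rel_sym : symmetric coset_rel.
Proof.
by move=> x y; apply/asboolP/asboolP => /subgroupV; rewrite invgM invgK.
Qed.

Fact coset_rel_trans : transitive coset_rel.
Proof.
move=> y x z /asboolP xy /asboolP yz; apply/asboolP.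
by have := subgroupM xy yz; rewrite mulgA -(mulgA _ y) mulgV mulg1.
Qed.

Canonical coset_rel_equiv :=
  EquivRel coset_rel coset_rel_refl coset_rel_sym coset_rel_trans.

Definition coset_space := {eq_quot coset_rel}.
HB.instance Definition _ := EqQuotient.on coset_space.
HB.instance Definition _ := Choice.on coset_space.

Lemma coset_spaceP (x y : G) :
  reflect (\pi_coset_space x = \pi_coset_space y) (coset_rel x y).
Proof. exact: eqmodP. Qed.

End CosetSpace.

Section LatticeSpace.
Variable F : fieldType.

Definition GL2 : Type := set_type [set g : 'M[laurent F]_2 | g \in unitmx].
HB.instance Definition _ := Topological.on GL2.

Definition mkGL2 (g : 'M[laurent F]_2) (gu : g \in unitmx) : GL2 :=
  exist _ g (mem_set gu).

Lemma GL2_unit (g : GL2) : \val g \in unitmx.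
Proof. exact: set_mem (valP g). Qed.

Lemma GL2_mul_subproof (g h : GL2) : \val g *m \val h \in unitmx.
Proof. by rewrite unitmx_mul !GL2_unit. Qed.

Lemma GL2_inv_subproof (g : GL2) : invmx (\val g) \in unitmx.
Proof. by rewrite unitmx_inv GL2_unit. Qed.

Definition GL2_one : GL2 := mkGL2 (unitmx1 _ 2).
Definition GL2_mul (g h : GL2) : GL2 := mkGL2 (GL2_mul_subproof g h).
Definition GL2_inv (g : GL2) : GL2 := mkGL2 (GL2_inv_subproof g).

Fact GL2_mulA : associative GL2_mul.
Proof. by move=> f g h; apply: val_inj; rewrite /= mulmxA. Qed.
Fact GL2_mul1 : left_id GL2_one GL2_mul.
Proof. by move=> g; apply: val_inj; rewrite /= mul1mx. Qed.
Fact GL2_mulr1 : right_id GL2_one GL2_mul.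
Proof. by move=> g; apply: val_inj; rewrite /= mulmx1. Qed.
Fact GL2_mulV : left_inverse GL2_one GL2_inv GL2_mul.
Proof. by move=> g; apply: val_inj; rewrite /= mulVmx ?GL2_unit. Qed.
Fact GL2_mulVr : right_inverse GL2_one GL2_inv GL2_mul.
Proof. by move=> g; apply: val_inj; rewrite /= mulmxV ?GL2_unit. Qed.

HB.instance Definition _ := isGroup.Build GL2
  GL2_mulA GL2_mul1 GL2_mulr1 GL2_mulV GL2_mulVr.

Definition is_scalarGL2 : set GL2 := [set g | is_scalar_mx (\val g)].

Fact scalarGL2_1 : is_scalarGL2 1%g.
Proof. exact: scalar_mx_is_scalar. Qed.
Fact scalarGL2_M g h : is_scalarGL2 g -> is_scalarGL2 h -> is_scalarGL2 (g * h)%g.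
Proof.
move=> /is_scalar_mxP [a ga] /is_scalar_mxP [b hb].
by rewrite /is_scalarGL2 /= ga hb -scalar_mxM scalar_mx_is_scalar.
Qed.
Fact scalarGL2_V g : is_scalarGL2 g -> is_scalarGL2 (g^-1)%g.
Proof.
move=> /is_scalar_mxP [a ga].
by rewrite /is_scalarGL2 /= ga invmx_scalar scalar_mx_is_scalar.
Qed.

Definition scalarGL2 : subgroup GL2 :=
  Subgroup scalarGL2_1 scalarGL2_M scalarGL2_V.

Definition PGL2 := quotient_topology (coset_space scalarGL2).
HB.instance Definition _ := Topological.on PGL2.
HB.instance Definition _ := Quotient.on PGL2.

Definition toPGL2 (g : GL2) : PGL2 := \pi_PGL2 g.

Lemma toPGL2P (g h : GL2) : toPGL2 g = toPGL2 h <-> is_scalarGL2 (g^-1 * h)%g.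
Proof.
rewrite -[is_scalarGL2 _]/(subgroup_set scalarGL2 _).
split; first by move=> /coset_spaceP /asboolP.
by move=> ?; apply/coset_spaceP/asboolP.
Qed.


Definition PGL2_mul (x y : PGL2) : PGL2 := toPGL2 (repr x * repr y)%g.
Definition PGL2_inv (x : PGL2) : PGL2 := toPGL2 (repr x)^-1%g.

Lemma toPGL2K (x : PGL2) : toPGL2 (repr x) = x.
Proof. exact: reprK. Qed.

Lemma scalar_commute (z g : GL2) : is_scalarGL2 z -> (z * g = g * z)%g.
Proof.
move=> /is_scalar_mxP [a za]; apply: val_inj => /=.
by rewrite za mul_scalar_mx mul_mx_scalar.
Qed.

Lemma repr_toPGL2 (g : GL2) : exists2 z, is_scalarGL2 z & repr (toPGL2 g) = (g * z)%g.
Proof.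
exists (g^-1 * repr (toPGL2 g))%g; last by rewrite mulgA mulgV mul1g.
by apply/toPGL2P; rewrite toPGL2K.
Qed.

Lemma toPGL2_scalar (g z : GL2) : is_scalarGL2 z -> toPGL2 (g * z)%g = toPGL2 g.
Proof. by move=> sz; apply/esym/toPGL2P; rewrite mulgA mulVg mul1g. Qed.

Lemma toPGL2M (g h : GL2) : PGL2_mul (toPGL2 g) (toPGL2 h) = toPGL2 (g * h)%g.
Proof.
rewrite /PGL2_mul; have [y sy ->] := repr_toPGL2 g.
have [z sz ->] := repr_toPGL2 h.
rewrite mulgA -(mulgA g) (scalar_commute h sy) mulgA -mulgA.
exact: (toPGL2_scalar (g * h)%g (scalarGL2_M sy sz)).
Qed.

Lemma toPGL2V (g : GL2) : PGL2_inv (toPGL2 g) = toPGL2 (g^-1)%g.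
Proof.
rewrite /PGL2_inv; have [z sz ->] := repr_toPGL2 g.
rewrite invgM (scalar_commute _ (scalarGL2_V sz)) toPGL2_scalar //.
exact: scalarGL2_V.
Qed.

Fact PGL2_mulA : associative PGL2_mul.
Proof.
move=> x y z; rewrite -(toPGL2K x) -(toPGL2K y) -(toPGL2K z).
by rewrite !toPGL2M mulgA.
Qed.
Fact PGL2_mul1 : left_id (toPGL2 1%g) PGL2_mul.
Proof. by move=> x; rewrite -(toPGL2K x) toPGL2M mul1g. Qed.
Fact PGL2_mulr1 : right_id (toPGL2 1%g) PGL2_mul.
Proof. by move=> x; rewrite -(toPGL2K x) toPGL2M mulg1. Qed.
Fact PGL2_mulV : left_inverse (toPGL2 1%g) PGL2_inv PGL2_mul.
Proof. by move=> x; rewrite -(toPGL2K x) toPGL2V toPGL2M mulVg. Qed.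
Fact PGL2_mulVr : right_inverse (toPGL2 1%g) PGL2_inv PGL2_mul.
Proof. by move=> x; rewrite -(toPGL2K x) toPGL2V toPGL2M mulgV. Qed.

HB.instance Definition _ := isGroup.Build PGL2
  PGL2_mulA PGL2_mul1 PGL2_mulr1 PGL2_mulV PGL2_mulVr.

Definition is_integral (g : GL2) : Prop :=
  exists2 u : 'M[{poly F}]_2, u \in unitmx & \val g = map_mx (@poly_laurent F) u.

Definition is_PGL2R : set PGL2 := [set toPGL2 g | g in is_integral].

Fact PGL2R_1 : is_PGL2R 1%g.
Proof.
by exists 1%g => //; exists 1%:M; rewrite ?unitmx1 // map_mx1.
Qed.
Fact PGL2R_M x y : is_PGL2R x -> is_PGL2R y -> is_PGL2R (x * y)%g.
Proof.
move=> [g [u uU gu] <-] [h [w wU hw] <-]; exists (g * h)%g; last by rewrite -toPGL2M.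
by exists (u *m w); rewrite ?unitmx_mul ?uU // map_mxM /= gu hw.
Qed.
Fact PGL2R_V x : is_PGL2R x -> is_PGL2R (x^-1)%g.
Proof.
move=> [g [u uU gu] <-]; exists (g^-1)%g; last by rewrite -toPGL2V.
exists (invmx u); rewrite ?unitmx_inv // /= gu.
have fU : map_mx (@poly_laurent F) u \in unitmx by rewrite -gu GL2_unit.
apply: (can_inj (mulKmx fU)); rewrite mulmxV //.
by rewrite -map_mxM mulmxV // map_mx1.
Qed.

Definition PGL2R : subgroup PGL2 := Subgroup PGL2R_1 PGL2R_M PGL2R_V.

Definition Xinf := quotient_topology (coset_space PGL2R).
HB.instance Definition _ := Topological.on Xinf.
HB.instance Definition _ := Quotient.on Xinf.

Definition toXinf (a : PGL2) : Xinf := \pi_Xinf a.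
HB.instance Definition _ := isPointed.Build Xinf (toXinf 1%g).

Definition Xact (a : PGL2) (x : Xinf) : Xinf := toXinf (a * repr x)%g.

Lemma XactE (a b : PGL2) : Xact a (toXinf b) = toXinf (a * b)%g.
Proof.
apply/esym/coset_spaceP/asboolP.
have /coset_spaceP /asboolP : toXinf b = toXinf (repr (toXinf b)).
  by rewrite [RHS]reprK.
by rewrite invgM -mulgA (mulgA a^-1%g) mulVg mul1g.
Qed.

Definition Ainf : set PGL2 :=
  [set toPGL2 g | g in [set g : GL2 | is_diag_mx (\val g)]].

Definition Aorbit (x : Xinf) : set Xinf := [set Xact a x | a in Ainf].

Definition A_periodic (x : Xinf) : Prop := compact (Aorbit x).

Definition Xborel := g_sigma_algebraType (@open Xinf).

End LatticeSpace.

Section LatticeModules.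
Variables (K : fieldType) (S : set K).

Definition add_coset (V : lmodType K) (N : set V) (v : V) : set V :=
  [set v + n | n in N].

Definition coset_quot (V : lmodType K) (M N : set V) : set (set V) :=
  [set add_coset N v | v in M].

(* The S-modules M / N and M' / N' are isomorphic. *)
Definition quot_isom (V W : lmodType K) (M N : set V) (M' N' : set W) : Prop :=
  exists phi : set V -> set W,
    set_bij (coset_quot M N) (coset_quot M' N') phi /\
    forall r u v s t, S r -> M u -> M v -> M' s -> M' t ->
      phi (add_coset N u) = add_coset N' s ->
      phi (add_coset N v) = add_coset N' t ->
      phi (add_coset N (r *: u + v)) = add_coset N' (r *: s + t).

End LatticeModules.

Section Graph.
Variables (V : Type) (adj : V -> V -> Prop).

Fixpoint walk (n : nat) (x y : V) : Prop :=
  if n is m.+1 then exists2 z, adj x z & walk m z y else x = y.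

Definition component (x : V) : set V := [set y | exists n, walk n x y].

Definition graph_dist (x y : V) (n : nat) : Prop :=
  walk n x y /\ forall m, walk m x y -> (n <= m)%N.

Definition geodesic_ray (r : nat -> V) : Prop :=
  forall m n, graph_dist (r m) (r (m + n)%N) n.

Definition component_ray (x : V) : set (nat -> V) :=
  [set r | geodesic_ray r /\ forall n, component x (r n)].

(* Two geodesic rays of a tree are asymptotic iff they eventually coincide,
   up to a shift. *)
Definition asymptotic (r s : nat -> V) : Prop :=
  exists k l : nat, forall n : nat, r (k + n)%N = s (l + n)%N.

Definition end_of (x : V) (r : nat -> V) : set (nat -> V) :=
  [set s | component_ray x s /\ asymptotic r s].

Definition ends (x : V) : set (set (nat -> V)) :=
  [set end_of x r | r in component_ray x].

Definition ray_to (x : V) (xi : set (nat -> V)) (r : nat -> V) : Prop :=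
  xi r /\ r 0%N = x.

End Graph.

Section Hecke.
Variable F : fieldType.

Definition Rinf : set (laurent F) := range (@poly_laurent F).

Definition lattice_image (g : GL2 F) (L : set 'cV[{poly F}]_2) :
    set 'cV[laurent F]_2 :=
  [set \val g *m map_mx (@poly_laurent F) u | u in L].

(* Points of Xinf as homothety classes of R-lattices: the coset of g is the
   class of g (R^2), whose members are the c g (R^2), c != 0. *)
Definition lattice_in_class (L : set 'cV[laurent F]_2) (x : Xinf F) : Prop :=
  exists g c, [/\ c != 0, toXinf (toPGL2 g) = x &
    L = [set c *: v | v in lattice_image g setT]].

Variable nu : prime_poly F.

Definition nuRinf : set (laurent F) :=
  [set poly_laurent (pval nu) * r | r in Rinf].

Definition hecke_edge (x y : Xinf F) : Prop :=
  exists L L', [/\ lattice_in_class L x, lattice_in_class L' y, L' `<=` L &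
    @quot_isom _ Rinf 'cV[laurent F]_2 (laurent F)^o L L' Rinf nuRinf].

Definition hecke_adj (x y : Xinf F) : Prop := hecke_edge x y \/ hecke_edge y x.

Definition hecke_boundary (x0 : Xinf F) := ends hecke_adj x0.

Local Notation K := {fraction {poly F}}.
Definition Knu := completion (nu_valuation nu).
HB.instance Definition _ := GRing.Field.on Knu.

Definition to_Knu (x : K) : Knu := to_completion (nu_valuation nu) x.
Definition poly_Knu (f : {poly F}) : Knu := to_Knu (FracField.tofrac f).

Definition Onu : set Knu := @completion_ring _ (nu_valuation nu).
Definition nuOnu : set Knu := [set poly_Knu (pval nu) * t | t in Onu].

(* Every point of the projective line over Knu has such coordinates, unique up
   to a unit of Onu. *)
Definition primitive_coords (ab : 'cV[Knu]_2) : Prop :=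
  (forall i, Onu (ab i 0)) /\ ~ (forall i, nuOnu (ab i 0)).

(* [a : b] is in the image of the projective line over K. *)
Definition rational_coords (ab : 'cV[Knu]_2) : Prop :=
  exists (c : Knu) (k : 'cV[K]_2),
    [/\ c != 0, k != 0 & ab = c *: map_mx to_Knu k].

Definition sublattice (ab : 'cV[Knu]_2) (n : nat) : set 'cV[{poly F}]_2 :=
  [set u | exists (t : Knu) (w : 'cV[Knu]_2),
    [/\ Onu t, (forall i, Onu (w i 0)) &
    map_mx poly_Knu u = t *: ab + poly_Knu (pval nu) ^+ n *: w]].

Definition end_at (g : GL2 F) (ab : 'cV[Knu]_2) (x0 : Xinf F)
    (xi : set (nat -> Xinf F)) : Prop :=
  exists r,
    [/\ forall n, lattice_in_class (lattice_image g (sublattice ab n)) (r n),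
    component_ray hecke_adj x0 r & xi = end_of hecke_adj x0 r].

(* The condition does not depend on the choice of g. *)
Definition rational_end (x0 : Xinf F) (xi : set (nat -> Xinf F)) : Prop :=
  exists g ab, [/\ toXinf (toPGL2 g) = x0, primitive_coords ab,
    rational_coords ab & end_at g ab x0 xi].

End Hecke.

Section Measures.
Variables (R : realType) (F : fieldType).

(* The A-invariant probability measure on the orbit of x, extended by 0 to the
   Borel sets of Xinf. *)
Definition orbit_measure (x : Xinf F) (m : probability (Xborel F) R) : Prop :=
  m (Aorbit x) = 1%E /\
  forall (a : PGL2 F) (B : set (Xborel F)), Ainf a -> measurable B ->
    m (Xact a @^-1` B) = m B.

Definition Cc : set (Xinf F -> R) :=
  [set f | continuous f /\ compact (closure (f @^-1` [set~ 0]))].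

(* Positive measures as functionals on Cc: the weak-star topology is the
   topology of pointwise convergence of these functionals. *)
Definition functional (m : {measure set (Xborel F) -> \bar R}) :
    {ptws Cc -> R} :=
  fun f => Rintegral m setT (\val f).

(* Finiteness on compact sets makes every function of Cc integrable. *)
Definition weak_star_accumulation
    (mu : nat -> {measure set (Xborel F) -> \bar R})
    (m : {measure set (Xborel F) -> \bar R}) : Prop :=
  (forall C : set (Xinf F), compact C -> (m C < +oo)%E) /\
  cluster ((fun n => functional (mu n)) @ \oo) (functional m).

(* For a periodic base point, the ray x from x0 to xi and the measures mu n are
   uniquely determined (the measures, on Borel sets). *)
Definition Theta (nu : prime_poly F) (x0 : Xinf F) (xi : set (nat -> Xinf F)) :
    set {measure set (Xborel F) -> \bar R} :=
  [set m | exists x (mu : nat -> probability (Xborel F) R),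
    [/\ ray_to x0 xi x, forall n, orbit_measure (x n) (mu n) &
        weak_star_accumulation mu m]].

End Measures.

(* Main.v *)
Require Import Defs.
From HB Require Import structures.
From mathcomp Require Import all_boot all_order all_algebra.
From mathcomp Require Import all_classical all_reals all_analysis.
From mathcomp Require Import measurable_realfun.
From mathcomp Require Import zify ring lra.

(** The example is the field with two elements, [nu = Y] and the order [F[Y][f]],
    where [f] is a root of [z^2 = Y z + 1]. Its conjugate [eps = Y + f] is also
    its inverse, so [eps] is a unit; embedding the order by its two places at
    infinity gives a lattice with a compact orbit.

    The Frobenius map gives [eps^(2^k) = a + Y^n eps] with [a] a polynomial and
    [n = 2^k - 1] ([root_pow]). Hence [eps^(2^k)] stabilizes every lattice
    between [Y^n L] and [L], where [L] is the initial lattice; these lattices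
    include the vertices of index at most [n] of every ray from the class of [L].
    Each of them is thus fixed by [diag(Y^-j, 1)] with [j = 2^(k+1)], up to a unit
    of the valuation ring ([periodic_lattice]).

    On the other hand, a rational end is a line spanned by some nonzero [v] in
    [L] belonging to all the lattices [L_n] along the ray, while the covolume
    of [L_n] is at least of order [2^n] ([sublattice_rational],
    [sublattice_det]). In the lattices [diag(Y^-j, 1) L_n] with [n = 2^k - 1]
    and [0 <= j < 2^(k+1)], normalized to covolume 1, the image of [v] is
    short as long as [n - j] is large, and that of [eps^(2^k) v], which also
    belongs to [L_n], is short as soon as [j - n] is large. Up to height [h],
    only a number of values of [j] which depends on [h] and [v], and not
    on [k], is left ([escape_window]): the measure of the compact sets on
    these orbits tends to 0 like [2^-k].

    To obtain the measures themselves, one-units are identified with the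
    Cantor space of their coefficients. Multiplication by a one-unit becomes an
    isometry of this space, so it preserves the coin tossing measure, which is
    the law of the binary digits of a uniform real number
    ([coin_tossing_ex]). The invariant probability of a periodic orbit is the
    average over one period of images of this measure ([orbit_measure_ex]). *)

Set Implicit Arguments.
Unset Strict Implicit.
Unset Printing Implicit Defensive.

Import Order.TTheory GRing.Theory Num.Theory.
Import numFieldNormedType.Exports.

Local Open Scope classical_set_scope.
Local Open Scope ring_scope.

(** * Orders of Laurent series *)

Section LaurentOrder.
Variable F : fieldType.
Implicit Types (f g u : laurent F) (N M i j n : int).

(** The order of [f] at infinity is at least [N], that is, the absolute value of
    [f] is at most [q^-N] if that of [Y] is [q]. The order of 0 is infinite. *)
Definition lge N f := forall n, n < N -> f n = 0.

Lemma lcoefD f g n : (f + g) n = f n + g n. Proof. by []. Qed.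
Lemma lcoefN f n : (- f) n = - f n. Proof. by []. Qed.
Lemma lcoefB f g n : (f - g) n = f n - g n. Proof. by []. Qed.
Lemma lcoef0 n : (0 : laurent F) n = 0. Proof. by []. Qed.
Lemma lcoef1 n : (1 : laurent F) n = (n == 0)%:R. Proof. by []. Qed.
Lemma lcoefM f g n : (f * g) n = laurent_conv f g n. Proof. by []. Qed.

Lemma lge_ex f : exists N, lge N f.
Proof. exact: laurent_bounded. Qed.

Lemma lge_le M N f : M <= N -> lge N f -> lge M f.
Proof. by move=> MN fN n nM; apply: fN; exact: lt_le_trans MN. Qed.

Lemma lge0 N : lge N 0. Proof. by []. Qed.

Lemma lge1 : lge 0 1.
Proof. by move=> n n0; rewrite lcoef1 lt_eqF. Qed.

Lemma lgeD N f g : lge N f -> lge N g -> lge N (f + g).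
Proof. by move=> fN gN n nN; rewrite lcoefD fN // gN // addr0. Qed.

Lemma lgeN N f : lge N f -> lge N (- f).
Proof. by move=> fN n nN; rewrite lcoefN fN // oppr0. Qed.

Lemma lgeB N f g : lge N f -> lge N g -> lge N (f - g).
Proof. by move=> fN gN; apply: lgeD => //; exact: lgeN. Qed.

Lemma lgeBC N f g : lge N (f - g) -> lge N (g - f).
Proof. by move=> /lgeN; rewrite opprB. Qed.

Lemma lgeM M N f g : lge M f -> lge N g -> lge (M + N) (f * g).
Proof.
move=> fM gN n nMN; rewrite lcoefM /laurent_conv fsbig1 // => i _.
have [/fM ->|iM] := ltP i M; first by rewrite mul0r.
by rewrite gN ?mulr0 //; lia.
Qed.

Lemma lge_sum (I : Type) (r : seq I) (P : pred I) (h : I -> laurent F) N :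
  (forall k, P k -> lge N (h k)) -> lge N (\sum_(k <- r | P k) h k).
Proof. by move=> hN; apply: big_ind => // *; exact: lgeD. Qed.

Lemma lcoefM_lead M N f g : lge M f -> lge N g ->
  (f * g) (M + N) = f M * g N.
Proof.
move=> fM gN; rewrite lcoefM /laurent_conv -(fsbig_widen [set M]) //; last first.
  move=> i [_ /= /eqP iM]; have [/fM ->|Mi] := ltP i M; first by rewrite mul0r.
  by rewrite gN ?mulr0 //; lia.
by rewrite fsbig_set1; congr (_ * lcoef g _); lia.
Qed.

Lemma lge_recl N f : lge N f -> f N = 0 -> lge (N + 1) f.
Proof.
move=> fN f0 n; have [->//|nN] := eqVneq n N.
by move=> nN1; apply: fN; lia.
Qed.

(** Leading coefficients multiply without cancellation, so that orders add up;
    stated as a cancellation rule, this covers the product with 0. *)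
Lemma lgeMK v N f g : lge v f -> f v != 0 -> lge (v + N) (f * g) -> lge N g.
Proof.
move=> fv fv0 fgN; have [->|g0] := eqVneq g 0; first exact: lge0.
have [w [gw0 gw]] := laurent_lead g0; apply: lge_le (gw); rewrite leNgt.
apply/negP => wN; have /eqP := lcoefM_lead fv gw.
by rewrite fgN ?ltrD2l // eq_sym mulf_eq0 (negPf fv0) (negPf gw0).
Qed.

Fact lT_subproof j : bounded_below (fun n => (n == j)%:R : F).
Proof. by exists j => n; case: eqP => // ->; rewrite ltxx. Qed.
Definition lT j : laurent F := mk_laurent (lT_subproof j).

Lemma lcoefT j n : lT j n = (n == j)%:R. Proof. by []. Qed.

Lemma lge_T j : lge j (lT j).
Proof. by move=> n nj; rewrite lcoefT lt_eqF. Qed.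

Lemma lcoefTM j f n : (lT j * f) n = f (n - j).
Proof.
rewrite lcoefM /laurent_conv -(fsbig_widen [set j]) //; last first.
  by move=> i [_ /= /eqP/negPf ij]; rewrite ij mul0r.
by rewrite fsbig_set1 lcoefT eqxx mul1r.
Qed.

Lemma lT0 : lT 0 = 1. Proof. exact: laurentP. Qed.

Lemma lTD i j : lT (i + j) = lT i * lT j.
Proof. by apply: laurentP => n; rewrite lcoefTM !lcoefT; congr (_%:R); lia. Qed.

Lemma lT_neq0 j : lT j != 0.
Proof.
by apply/eqP => /(congr1 (fun f : laurent F => f j)) /eqP; rewrite lcoefT eqxx oner_eq0.
Qed.

Lemma lgeTM j N f : lge N f -> lge (j + N) (lT j * f).
Proof. by apply: lgeM; exact: lge_T. Qed.

Definition unit1 u := lge 1 (u - 1).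

Lemma unit1_ge u : unit1 u -> lge 0 u.
Proof.
move=> u1; rewrite -[u](subrK 1); apply: lgeD lge1.
by apply: lge_le u1.
Qed.

Lemma unit1_coef0 u : unit1 u -> u 0 = 1.
Proof. by move=> /(_ 0 isT) /eqP; rewrite lcoefB lcoef1 eqxx subr_eq0 => /eqP. Qed.

Lemma unit1P u : lge 0 u -> u 0 = 1 -> unit1 u.
Proof.
move=> u0 u1; have := lge_recl (lgeB u0 lge1); apply.
by rewrite lcoefB lcoef1 u1 subrr.
Qed.

Lemma unit1_neq0 u : unit1 u -> u != 0.
Proof.
move=> /unit1_coef0 u1; apply/eqP => u0; move/eqP: u1.
by rewrite u0 lcoef0 eq_sym oner_eq0.
Qed.

Lemma unit1_1 : unit1 1. Proof. by rewrite /unit1 subrr. Qed.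

Lemma unit1M u v : unit1 u -> unit1 v -> unit1 (u * v).
Proof.
move=> u1 v1; rewrite /unit1 (_ : _ - 1 = (u - 1) * v + (v - 1)); last by ring.
by apply: lgeD => //; apply: lge_le (lgeM u1 (unit1_ge v1)); lia.
Qed.

Lemma unit1_geM u N f : unit1 u -> lge N (u * f) -> lge N f.
Proof.
move=> u1; rewrite -{1}[N]add0r; apply: lgeMK (unit1_ge u1) _.
by rewrite unit1_coef0 // oner_neq0.
Qed.

Lemma unit1V u : unit1 u -> unit1 u^-1.
Proof.
move=> u1; have u0 := unit1_neq0 u1; apply: (unit1_geM u1).
rewrite mulrBr divff // mulr1; exact: lgeBC.
Qed.

Lemma lcoef_poly p n :
  poly_laurent p n = if n <= 0 then p`_(absz n) else 0 :> F.
Proof. by []. Qed.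

(** A nonzero polynomial is not small at infinity: this makes lattices
    discrete. *)
Lemma poly_lge_eq0 (p : {poly F}) : lge 1 (poly_laurent p) -> p = 0.
Proof.
move=> h; apply/polyP => i; rewrite coef0.
have := h (- i%:Z); rewrite lcoef_poly ifT; last by lia.
by rewrite abszN absz_nat; apply; lia.
Qed.

Lemma poly_lge_size (p : {poly F}) m :
  (m < size p)%N -> ~ lge (1 - m%:Z) (poly_laurent p).
Proof.
move=> mp /(_ (- ((size p).-1)%:Z)); rewrite lcoef_poly ifT; last by lia.
rewrite abszN absz_nat => h.
have /eqP : p`_(size p).-1 = 0 by apply: h; lia.
by rewrite lead_coef_eq0 -size_poly_eq0; lia.
Qed.

Lemma poly_laurent_inj : injective (@poly_laurent F).
Proof.
move=> p q pq; apply/eqP; rewrite -subr_eq0; apply/eqP/poly_lge_eq0.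
by rewrite rmorphB /= pq subrr.
Qed.

Lemma poly_laurentX : poly_laurent 'X = lT (-1).
Proof.
apply: laurentP => n; rewrite lcoef_poly lcoefT coefX.
by case: ifP => n0; [congr (_%:R); lia | case: eqP => // e; lia].
Qed.

End LaurentOrder.
Arguments lge0 {F} N.
Arguments lge1 {F}.
Arguments unit1_1 {F}.

(** * Laurent series over the field with two elements *)

Section TwoElements.
Variable F : fieldType.
Hypothesis F01 : forall c : F, c = 0 \/ c = 1.
Implicit Types (f g u : laurent F).

Lemma two_nonzero (c : F) : c <> 0 -> c = 1.
Proof. by case: (F01 c). Qed.

Lemma addff (c : F) : c + c = 0.
Proof.
have [->|->] := F01 c; first by rewrite addr0.
have [//|/eqP] := F01 (1 + 1).
by rewrite -subr_eq0 addrK oner_eq0.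
Qed.

Lemma laurent_addff f : f + f = 0.
Proof. by apply: laurentP => n; rewrite lcoefD addff. Qed.

Lemma laurent_sqrD f g : (f + g) ^+ 2 = f ^+ 2 + g ^+ 2.
Proof. by rewrite sqrrD mulr2n laurent_addff addr0. Qed.

(** There are no other constant units than 1, so the multiplicative group is
    generated by the uniformizer and the one-units. *)
Lemma laurent_polar f : f != 0 -> exists j u, unit1 u /\ f = lT F j * u.
Proof.
move=> /laurent_lead [v [/eqP/two_nonzero fv lef]].
exists v, (lT F (- v) * f); split; last first.
  by rewrite mulrA -lTD subrr lT0 mul1r.
apply: unit1P; last by rewrite lcoefTM sub0r opprK.
by rewrite -(addNr v); apply: lgeTM.
Qed.

End TwoElements.

(** * A quadratic unit *)

Section QuadraticUnit.
Variable F : fieldType.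
Implicit Types (f g : laurent F).
Local Notation T := (lT F 1).

Fixpoint root_approx m : laurent F :=
  if m is k.+1 then T * (1 + root_approx k ^+ 2) else 0.

Lemma root_approx_ge m : lge 1 (root_approx m).
Proof.
elim: m => // m IH; rewrite /=; suff h : lge 0 (1 + root_approx m ^+ 2).
  by apply: lge_le (lgeTM (j := 1) h); lia.
apply: lgeD; first exact: lge1.
by rewrite expr2; apply: lge_le (lgeM IH IH).
Qed.

Lemma root_approx_step m : lge m%:Z (root_approx m.+1 - root_approx m).
Proof.
elim: m => [|m IH].
  by rewrite subr0; apply: lge_le (root_approx_ge 1).
rewrite (_ : _ - _ =
  T * ((root_approx m.+1 - root_approx m) * (root_approx m.+1 + root_approx m))).
  apply: lge_le (lgeTM (j := 1) (lgeM IH (lgeD (root_approx_ge _) (root_approx_ge _)))).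
  lia.
rewrite -[root_approx m.+2]/(T * (1 + root_approx m.+1 ^+ 2)).
rewrite -[X in _ - X]/(T * (1 + root_approx m ^+ 2)); ring.
Qed.

Lemma root_approx_cauchy m k : lge m%:Z (root_approx (m + k)%N - root_approx m).
Proof.
elim: k => [|k IH]; first by rewrite addn0 subrr.
rewrite addnS -(subrK (root_approx (m + k)) (root_approx _.+1)) -addrA.
apply: lgeD IH.
by apply: lge_le (@root_approx_step (m + k)); lia.
Qed.

(** The equation [f^2 + 1 = Y f] has a solution of absolute value less than 1,
    as [f |-> Y^-1 (1 + f^2)] is a contraction there. *)
Lemma small_root_ex : exists2 f, lge 1 f & f = T * (1 + f ^+ 2).
Proof.
have bf : bounded_below (fun n : int => root_approx (absz n).+1 n).
  by exists 0 => n n0; apply: root_approx_ge; lia.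
pose f := mk_laurent bf.
have fE n : f n = root_approx (absz n).+1 n by [].
have fm m : lge m%:Z (f - root_approx m).
  move=> n nm; rewrite lcoefB fE; have [n0|n0] := ltP n 0.
    have e k : root_approx k n = 0.
      by apply: root_approx_ge; lia.
    by rewrite !e subr0.
  have -> : m = ((absz n).+1 + (m - (absz n).+1))%N by lia.
  have /eqP := @root_approx_cauchy (absz n).+1 (m - (absz n).+1) n ltac:(lia).
  by rewrite lcoefB subr_eq0 => /eqP ->; rewrite subrr.
have f1 : lge 1 f by move=> n n1; apply: root_approx_ge.
exists f => //; apply/eqP; rewrite -subr_eq0; apply/eqP/laurentP => n.
have := fm `|n|.+1; have := fm `|n|.+2; set g := root_approx _ => fg fg'.
rewrite (_ : f - _ = (f - T * (1 + root_approx `|n|.+1 ^+ 2))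
   - T * ((f - root_approx `|n|.+1) * (f + root_approx `|n|.+1))); last by ring.
apply: (@lgeB _ (`|n|.+1)%:Z); [by apply: lge_le fg; lia| |by lia].
apply: lge_le (lgeTM (j := 1) (lgeM fg' (lgeD f1 (root_approx_ge _)))).
lia.
Qed.

End QuadraticUnit.

(** * Lattices with short vectors *)

Lemma det2 (R : comNzRingType) (A : 'M[R]_2) :
  \det A = A 0 0 * A 1 1 - A 0 1 * A 1 0.
Proof.
rewrite (expand_det_row _ ord0) !big_ord_recl big_ord0 addr0.
rewrite /cofactor !det_mx11 !mxE /= expr0 mul1r expr1 mulN1r mulrN.
by congr (A _ _ * A _ _ - A _ _ * A _ _); apply: val_inj.
Qed.

Section ShortVectors.
Variable F : fieldType.
Implicit Types (G K : 'M[laurent F]_2) (h : int).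

Definition pmx m n : 'M[{poly F}]_(m, n) -> 'M[laurent F]_(m, n) :=
  map_mx (@poly_laurent F).

Lemma pmxM m n k (A : 'M[{poly F}]_(m, n)) (B : 'M[{poly F}]_(n, k)) :
  pmx (A *m B) = pmx A *m pmx B.
Proof. exact: map_mxM. Qed.

Lemma pmx1 n : pmx (1%:M : 'M[{poly F}]_n) = 1%:M.
Proof. exact: map_mx1. Qed.

Lemma pmx_inj m n : injective (@pmx m n).
Proof.
move=> A B /matrixP AB; apply/matrixP => i j.
by have := AB i j; rewrite !mxE => /poly_laurent_inj.
Qed.

Lemma det_pmx n (A : 'M[{poly F}]_n) : \det (pmx A) = poly_laurent (\det A).
Proof. exact: det_map_mx. Qed.

Lemma pmx_unit n (A : 'M[{poly F}]_n) : A \in unitmx -> pmx A \in unitmx.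
Proof. by move=> Au; rewrite unitmxE det_pmx rmorph_unit // -unitmxE. Qed.

Definition mx_ge h m n (A : 'M[laurent F]_(m, n)) := forall i j, lge h (A i j).

Lemma mx_geM a b m n k (A : 'M[laurent F]_(m, n)) (B : 'M[laurent F]_(n, k)) :
  mx_ge a A -> mx_ge b B -> mx_ge (a + b) (A *m B).
Proof. by move=> Aa Bb i j; rewrite mxE; apply: lge_sum => *; apply: lgeM. Qed.

Lemma mx_ge_ex m n (A : 'M[laurent F]_(m, n)) : exists a, mx_ge a A.
Proof.
have [f fP] := boolp.choice (fun ij : 'I_m * 'I_n => lge_ex (A ij.1 ij.2)).
exists (\big[Num.min/0]_(ij : 'I_m * 'I_n) f ij) => i j.
by apply: lge_le (fP (i, j)); apply: bigmin_le_cond.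
Qed.

(** The coordinates of [G u] have absolute values at most [q^-m], while that of
    the determinant is at least [q^(h - 2 m)]: once the covolume of the lattice
    of basis [G] is normalized to 1, its vector [G u] has norm at most
    [q^(- h / 2)]. *)
Definition short h G := exists (u : 'cV[{poly F}]_2) (m : int),
  [/\ u != 0, mx_ge m (G *m pmx u) & ~ lge (m + m - h + 1) (\det G)].

Lemma short_le h h' G : h <= h' -> short h' G -> short h G.
Proof.
move=> hh' [u [m [u0 Gu dG]]]; exists u, m; split=> // dG'; apply: dG.
by apply: lge_le dG'; lia.
Qed.

Lemma short_scale h c G : c != 0 -> short h (c *: G) -> short h G.
Proof.
move=> c0 [u [m [u0 Gu dG]]]; have [v [cv lcv]] := laurent_lead c0.
exists u, (m - v); split=> //.
  move=> i j; apply: (lgeMK lcv cv).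
  by have := Gu i j; rewrite -scalemxAl mxE addrC subrK.
move=> dG'; apply: dG; rewrite detZ expr2 -mulrA.
by apply: lge_le (lgeM lcv (lgeM lcv dG')); lia.
Qed.

Lemma short_basis h G (w : 'M[{poly F}]_2) :
  w \in unitmx -> short h (G *m pmx w) -> short h G.
Proof.
move=> wu [u [m [u0 Gu dG]]]; exists (w *m u), m; split.
- by apply: contraNneq u0 => wu0; rewrite -[u](mulKmx wu) wu0 mulmx0.
- by rewrite pmxM mulmxA.
move=> dG'; apply: dG; rewrite det_mulmx det_pmx.
have : \det w \is a GRing.unit by rewrite -unitmxE.
rewrite poly_unitE => /andP[/size_poly1P [c c0 ->] _].
suff c0g : lge 0 (poly_laurent c%:P).
  by apply: lge_le (lgeM dG' c0g); lia.
move=> n n0; rewrite lcoef_poly ifT; last by lia.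
by rewrite coefC; case: eqP => // n0'; lia.
Qed.

(** A matrix congruent to 1 is an isometry for the maximum norm. An
    inequality that holds for [K w] passes to [w] one degree at a time, as
    [(K - 1) w] is smaller than [w]. *)
Lemma mx_ge_near K m (w : 'cV[laurent F]_2) :
  mx_ge 1 (K - 1%:M) -> mx_ge m (K *m w) -> mx_ge m w.
Proof.
move=> K1 Kw; have [M wM] := mx_ge_ex w.
have step k : mx_ge (Num.min m (M + k%:Z)) w.
  elim: k => [|k IH] i j; first by apply: lge_le (wM i j); lia.
  have -> : w i j = (K *m w) i j - ((K - 1%:M) *m w) i j.
    have e : w = K *m w - (K - 1%:M) *m w.
      by rewrite mulmxBl mul1mx opprB addrC subrK.
    by rewrite {1}e mxE; congr (_ + _); rewrite mxE.
  apply: lgeB; first by apply: lge_le (Kw i j); lia.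
  by apply: lge_le (mx_geM K1 IH i j); lia.
by move=> i j; apply: lge_le (step `|m - M|%N i j); lia.
Qed.

Lemma unit1_det_near K : mx_ge 1 (K - 1%:M) -> unit1 (\det K).
Proof.
move=> K1; have Kd i : unit1 (K i i).
  by have := K1 i i; rewrite !mxE eqxx.
have Ko i j : i != j -> lge 1 (K i j).
  by move=> ij; have := K1 i j; rewrite !mxE (negPf ij) subr0.
rewrite det2 /unit1 addrAC; apply: lgeB.
  exact: (unit1M (Kd _) (Kd _)).
by apply: lge_le (lgeM (Ko 0 1 isT) (Ko 1 0 isT)).
Qed.

Lemma short_near h K G : mx_ge 1 (K - 1%:M) -> short h (K *m G) -> short h G.
Proof.
move=> K1 [u [m [u0 Gu dG]]]; exists u, m; split=> //.
  by apply: (mx_ge_near K1); rewrite mulmxA.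
move=> dG'; apply: dG; rewrite det_mulmx.
by rewrite -[X in lge X]add0r; apply: lgeM (unit1_ge (unit1_det_near K1)) dG'.
Qed.

(** Lattices are discrete: the shortest vectors have positive length. *)
Lemma short_bounded G : G \in unitmx -> exists h, ~ short h G.
Proof.
move=> Gu; have [a Ga] := mx_ge_ex (invmx G); have [d Gd] := lge_ex (\det G).
exists (1 - a - a - d) => -[u [m [/eqP u0 Gum]]]; apply.
have ma : m + a <= 0.
  rewrite leNgt; apply/negP => ma0; apply: u0; apply/matrixP => i j.
  rewrite mxE; apply: poly_lge_eq0.
  have := mx_geM Ga Gum i j; rewrite mulKmx // mxE; apply: lge_le; lia.
by apply: lge_le Gd; lia.
Qed.

End ShortVectors.

(** * The space of lattices *)

Section LatticeSpaceTheory.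
Variable F : fieldType.
Implicit Types (g : GL2 F) (x : Xinf F).

(** The class of the lattice of basis [g]. *)
Definition lat g : Xinf F := toXinf (toPGL2 g).

Lemma lat_surj x : exists g, lat g = x.
Proof. by exists (repr (repr x)); rewrite /lat toPGL2K [LHS]reprK. Qed.

Lemma latP g g' : lat g = lat g' <->
  exists c u, [/\ c != 0, u \in unitmx & \val g' = c *: (\val g *m pmx u)].
Proof.
have e : ((toPGL2 g)^-1 * toPGL2 g')%g = toPGL2 (g^-1 * g')%g.
  by rewrite -toPGL2M -toPGL2V.
split.
  move=> /coset_spaceP /asboolP; rewrite e => -[h [u uu hu]].
  move=> /toPGL2P /is_scalar_mxP [c /= hc]; exists c, u.
  have g'E : \val g' = c *: (\val g *m pmx u).
    rewrite -[pmx u]hu scalemxAr -mul_mx_scalar -hc.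
    by rewrite !mulKVmx ?GL2_unit.
  split=> //; apply/eqP => c0; have := GL2_unit g'.
  by rewrite g'E c0 scale0r unitmxE det0 unitr0.
move=> [c [u [c0 uu g'E]]]; apply/coset_spaceP/asboolP; rewrite e.
exists (mkGL2 (pmx_unit uu)); first by exists u.
apply/toPGL2P/is_scalar_mxP; exists c; rewrite /= g'E.
rewrite -scalemxAr mulKmx ?GL2_unit // -scalemxAr mulVmx ?pmx_unit //.
by rewrite scalemx1.
Qed.

Lemma Xact_lat k g : Xact (toPGL2 k) (lat g) = lat (k * g)%g.
Proof. by rewrite XactE; congr toXinf; exact: toPGL2M. Qed.

Lemma laurent_nbhsP (f : laurent F) A :
  nbhs f A <-> exists N, forall f', lge N (f' - f) -> A f'.
Proof.
rewrite -nbhs_entourageE; split.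
  move=> [E [N _ NE] EA]; exists N => f' ff'; apply: EA; apply/xsectionP/NE.
  by move=> n nN /=; apply/eqP; rewrite eq_sym -subr_eq0 -lcoefB ff'.
move=> [N NA]; exists (laurent_ball N); first by exists N.
move=> f' /xsectionP ff'; apply: NA => n nN.
by rewrite lcoefB -(ff' n nN) subrr.
Qed.

Lemma GL2_nbhsP g A :
  nbhs g A <-> exists N, forall g', mx_ge N (\val g' - \val g) -> A g'.
Proof.
split.
  move=> [_ [[W oW <-] /= Wg WA]].
  have [P PW PA] : nbhs (\val g) W by apply: open_nbhs_nbhs.
  have [f fP] := boolp.choice (fun ij : 'I_2 * 'I_2 =>
    (laurent_nbhsP _ _).1 (PW ij.1 ij.2)).
  exists (\big[Num.max/0]_(ij : 'I_2 * 'I_2) f ij) => g' gg'; apply: WA.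
  apply: PA => i j; apply: (fP (i, j)) => n nf.
  have := gg' i j n; rewrite !mxE; apply.
  by apply: lt_le_trans nf _; exact: (le_bigmax _ f (i, j)).
move=> [N NA].
suff : nbhs (\val g) [set M | mx_ge N (M - \val g)].
  move=> /(@initial_continuous _ _ (set_val : GL2 F -> _) g) gN.
  apply: (@filterS _ (nbhs g) _ (set_val @^-1` [set M | mx_ge N (M - \val g)])).
    by move=> g' /NA.
  exact: gN.
exists (fun i j => [set f | lge N (f - \val g i j)]) => [i j|M MP i j].
  by apply/laurent_nbhsP; exists N.
by have := MP i j; rewrite !mxE.
Qed.

(** The two quotient topologies and the induced topology reduce to congruences
    between matrices. *)
Lemma open_latP (W : set (Xinf F)) :
  open W <-> forall g, W (lat g) ->
    exists N, forall g', mx_ge N (\val g' - \val g) -> W (lat g').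
Proof.
rewrite -[open W]/(open (lat @^-1` W)) openE; split.
  by move=> Wo g /Wo /GL2_nbhsP.
by move=> Wo g /Wo /GL2_nbhsP.
Qed.


End LatticeSpaceTheory.

Section CuspNeighbourhoods.
Variable F : fieldType.
Implicit Types (g : GL2 F) (x : Xinf F) (c d : laurent F) (h : int).

(** These sets form a basis of neighbourhoods of the cusp as [h] grows. *)
Definition shortX h : set (Xinf F) :=
  [set x | exists2 g, lat g = x & short h (\val g)].

Lemma shortXP h g : shortX h (lat g) <-> short h (\val g).
Proof.
split; last by exists g.
move=> [g' /latP [c [u [c0 uu ->]]]] g'h.
apply: (@short_basis _ _ _ (invmx u)); first by rewrite unitmx_inv.
rewrite -scalemxAl -mulmxA -pmxM mulmxV // pmx1 mulmx1.
apply: (@short_scale _ _ c^-1); first by rewrite invr_eq0.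
by rewrite scalerA mulVf // scale1r.
Qed.

(** The lattices of bases [g] and [K g] have the same successive minima when [K]
    is congruent to 1. *)
Lemma shortX_closed h : open (~` shortX h).
Proof.
apply/open_latP => g gh; have [a ga] := mx_ge_ex (invmx (\val g)).
exists (1 - a) => g' gg' /shortXP g'h; apply/gh/shortXP.
apply: (@short_near _ _ (\val g' *m invmx (\val g))); last first.
  by rewrite mulmxKV ?GL2_unit.
rewrite -(mulmxV (GL2_unit g)) -mulmxBl => i j.
by apply: lge_le (mx_geM gg' ga i j); lia.
Qed.

(** The easy half of Mahler's criterion: the open sets [~` shortX h] grow with [h],
    and they cover the space as lattices are discrete. *)
Lemma compact_shortX (C : set (Xinf F)) :
  compact C -> exists h, C `<=` ~` shortX h.
Proof.
rewrite compact_cover => /(_ int setT (fun h => ~` shortX h)) [].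
- by move=> h _; exact: shortX_closed.
- move=> x _; have [g <-] := lat_surj x.
  have [h gh] := short_bounded (GL2_unit g).
  by exists h => // /shortXP.
move=> D _ CD; exists (\big[Num.max/0]_(h <- finmap.enum_fset D) h).
move=> x /CD [h /= hD xh] [g gx gh]; apply: xh; exists g => //.
by apply: short_le gh; apply: le_bigmax_seq.
Qed.

End CuspNeighbourhoods.

(** * The diagonal action *)

Section Diagonal.
Variable F : fieldType.
Implicit Types (g : GL2 F) (x : Xinf F) (c d : laurent F) (h : int).

Definition dmx c d : 'M[laurent F]_2 :=
  diag_mx (\row_i (if i == 0 then c else d)).

Lemma dmxE n c d (A : 'M[laurent F]_(2, n)) i j :
  (dmx c d *m A) i j = (if i == 0 then c else d) * A i j.
Proof. by rewrite mul_diag_mx !mxE. Qed.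

Lemma det_dmx c d : \det (dmx c d) = c * d.
Proof. by rewrite det_diag !big_ord_recl big_ord0 mulr1 !mxE. Qed.

Lemma dmxM a b c d : dmx a b *m dmx c d = dmx (a * c) (b * d).
Proof. by apply/matrixP => i j; rewrite dmxE !mxE; case: ifP; rewrite mulrnAr. Qed.

Lemma dmx_unit c d : c != 0 -> d != 0 -> dmx c d \in unitmx.
Proof. by move=> c0 d0; rewrite unitmxE det_dmx unitfE mulf_neq0. Qed.

(** The nonzero elements act through [diag(c, 1)]; 0 is made to act as 1, which
    turns the action into a total function. *)
Definition dnz c : laurent F := if c == 0 then 1 else c.

Fact dnz_neq0 c : dnz c != 0.
Proof. by rewrite /dnz; case: ifP => [_|->//]; exact: oner_neq0. Qed.

Definition dgl c : GL2 F := mkGL2 (dmx_unit (dnz_neq0 c) (oner_neq0 _)).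

Definition act c x : Xinf F := Xact (toPGL2 (dgl c)) x.

Lemma act_lat c g : act c (lat g) = lat (dgl c * g)%g.
Proof. exact: Xact_lat. Qed.

Lemma dglE c : c != 0 -> \val (dgl c) = dmx c 1.
Proof. by move=> c0; rewrite /= /dnz (negPf c0). Qed.

Lemma actM c d x : c != 0 -> d != 0 -> act (c * d) x = act c (act d x).
Proof.
move=> c0 d0; have [g <-] := lat_surj x; rewrite !act_lat; congr lat.
apply: val_inj; rewrite /= /dnz mulf_eq0 (negPf c0) (negPf d0) /=.
by rewrite mulmxA dmxM mulr1.
Qed.

Lemma act1 x : act 1 x = x.
Proof.
have [g <-] := lat_surj x; rewrite act_lat; congr lat; apply: val_inj.
rewrite -[LHS]/(\val (dgl 1) *m \val g) dglE ?oner_neq0 //.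
by apply/matrixP => i j; rewrite dmxE; case: ifP; rewrite mul1r.
Qed.

(** Modulo scalars, [diag(c, d)] is [diag(c / d, 1)]. *)
Lemma diag_act (a : PGL2 F) : Ainf a ->
  exists2 c, c != 0 & forall x, Xact a x = act c x.
Proof.
move=> [k dk <-]; have kE : \val k = dmx (\val k 0 0) (\val k 1 1).
  apply/matrixP => i j; rewrite !mxE; have [<-|ij] := eqVneq i j.
    by rewrite mulr1n; case: ifPn => [/eqP->//|]; case: i => -[|[]] //= lt_i _;
      congr (_ _ _); apply: val_inj.
  by rewrite mulr0n; move/is_diag_mxP: dk; apply.
have := GL2_unit k; rewrite kE unitmxE det_dmx unitfE mulf_eq0 negb_or.
set c := \val k 0 0; set d := \val k 1 1 => /andP[c0 d0].
have cd0 : c / d != 0 by rewrite mulf_neq0 ?invr_eq0.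
exists (c / d) => // x; have [g <-] := lat_surj x.
rewrite act_lat Xact_lat; apply/latP; exists d^-1, 1%:M.
split; [by rewrite invr_eq0 | exact: unitmx1 |].
rewrite pmx1 mulmx1 -[LHS]/(\val (dgl _) *m \val g) dglE //.
rewrite -[\val (k * g)%g]/(\val k *m \val g) kE.
apply/matrixP => i j; rewrite dmxE mxE dmxE -/c -/d.
by case: ifP => _; rewrite mulrA; [congr (_ * _); rewrite mulrC | rewrite mulVf].
Qed.

Lemma act_diag c : c != 0 -> exists2 a : PGL2 F, Ainf a & Xact a = act c.
Proof.
move=> c0; exists (toPGL2 (dgl c)) => //; exists (dgl c) => //.
exact: diag_mx_is_diag.
Qed.

Lemma AorbitE x : Aorbit x = [set act c x | c in [set c | c != 0]].
Proof.
apply/seteqP; split=> y.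
  by move=> [a /diag_act [c c0 ->] <-]; exists c.
by move=> [c /act_diag [a aA <-] <-]; exists a.
Qed.

Lemma act_open (W : set (Xinf F)) c x : open W -> c != 0 -> W (act c x) ->
  exists N, forall c', c' != 0 -> lge N (c' - c) -> W (act c' x).
Proof.
have [g <-] := lat_surj x => /open_latP oW c0; rewrite act_lat => /oW [N NW].
have [a ga] := mx_ge_ex (\val g).
exists (N - a) => c' c'0 cc'; rewrite act_lat; apply: NW => i j.
rewrite -![\val (_ * g)%g]/(\val (dgl _) *m \val g) !dglE //.
rewrite mxE [X in _ + X]mxE !dmxE -mulrBl; case: ifP => _.
  by apply: lge_le (lgeM cc' (ga i j)); lia.
by rewrite subrr mul0r.
Qed.

End Diagonal.

(** * Pointwise convergence *)

Lemma ptws_cvg (I : Type) (T : topologicalType) (G : set_system {ptws I -> T})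
    (f : {ptws I -> T}) : Filter G ->
  (forall i, (fun g : {ptws I -> T} => g i) @ G --> f i) -> G --> f.
Proof.
move=> FG Gf; apply/cvg_sup => i; apply/cvg_image.
  by rewrite eqEsubset; split=> v // _; exists (fun=> v).
move=> W /Gf GW; exists (@^~ i @^-1` W) => //.
by rewrite eqEsubset; split => [j [? + <-//]|j Wj]; exists (fun=> j).
Qed.

(** * Coin tossing *)

Definition pushforward_measure d d' (T1 : measurableType d)
    (T2 : measurableType d') (R : realFieldType) (m : {measure set T1 -> \bar R})
    (f : T1 -> T2) (mf : measurable_fun setT f) : {measure set T2 -> \bar R} :=
  measure_function_pushforward__canonical__measure_function_Measure m mf.

Section Mass1Probability.
Context d (T : measurableType d) (R : realType).
Variable m : {measure set T -> \bar R}.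
Hypothesis m1 : m setT = 1%E.

Definition mass1 : set T -> \bar R := m.
HB.instance Definition _ := Measure.on mass1.
HB.instance Definition _ := Measure_isProbability.Build _ _ _ mass1 m1.
Definition mass1_probability : probability T R := mass1.

End Mass1Probability.

Definition agree (N : nat) (s t : nat -> bool) :=
  forall i, (i < N)%N -> s i = t i.

Lemma agree_sym N s t : agree N s t -> agree N t s.
Proof. by move=> st i iN; rewrite st. Qed.

(** If a point of an open set [W] had neighbours outside of [W] sharing arbitrarily
    many terms with it, these neighbours would converge to it pointwise. *)
Lemma cantor_openP (W : set cantor_space) :
  open W <-> forall s, W s -> exists N, forall t, agree N s t -> W t.
Proof.
split=> [oW s Ws|h].
  apply: contrapT => /forallNP noN.
  have /boolp.choice [t tP] : forall N, exists t : cantor_space, agree N s t /\ ~ W t.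
    by move=> N; have /existsNP [t /not_implyP [st Wt]] := noN N; exists t.
  have ts : t @ \oo --> (s : cantor_space).
    apply: ptws_cvg => i A /nbhs_singleton As.
    by exists i.+1 => //= N /= iN; rewrite -((tP N).1 i iN).
  have [N _ tW] : \forall N \near \oo, W (t N) by apply: ts; exact: open_nbhs_nbhs.
  by have [_] := tP N; apply; exact: tW (leqnn N).
rewrite openE => s /h [N NW].
suff : nbhs s [set t : cantor_space | agree N s t] by apply: filterS => t /NW.
elim: N {NW} => [|N IH].
  by apply: filterS filterT => t _ i.
have sN : nbhs s (proj N @^-1` [set s N]) by apply: proj_continuous; exact: discrete_set1.
apply: filterS (filterI IH sN) => t [st /= tN] i; rewrite ltnS leq_eqVlt.
by move=> /predU1P[->|/st//]; rewrite -tN.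
Qed.

(** The number whose binary expansion is made of the first [N] terms of [s]; the
    cylinders of level [N] are its fibers. *)
Fixpoint code (s : nat -> bool) (N : nat) : nat :=
  if N is M.+1 then ((code s M).*2 + s M)%N else 0%N.

Lemma code_lt s N : (code s N < 2 ^ N)%N.
Proof. by elim: N => //= N IH; rewrite expnS; case: (s N); lia. Qed.

Lemma codeP s t N : code s N = code t N <-> agree N s t.
Proof.
elim: N => [|N IH] /=; first by split=> // _ i.
split=> [e|st].
  have [e1 e2] : code s N = code t N /\ s N = t N.
    by move: e; case: (s N); case: (t N) => /=; lia.
  by move=> i; rewrite ltnS leq_eqVlt => /predU1P[->//|]; apply: (IH.1 e1).
by rewrite (st N) // (IH.2 _) // => i iN; apply: st; exact: ltnW.
Qed.

Definition cyl N k : set cantor_space := [set s | code s N = k].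

Lemma cyl_open N k : open (cyl N k).
Proof.
by apply/cantor_openP => s sk; exists N => t /codeP st; rewrite /cyl /= -st.
Qed.

Definition CB := g_sigma_algebraType (@open cantor_space).


Definition cyls : set (set cantor_space) := [set A | exists N k, A = cyl N k].

(** Every open set is a countable union of cylinders. *)
Lemma measurable_CB : @measurable _ CB = <<s cyls >>.
Proof.
apply/seteqP; split; apply: smallest_sub; try exact: smallest_sigma_algebra.
  move=> W /cantor_openP oW.
  have -> : W = \bigcup_N \bigcup_(k in [set k | cyl N k `<=` W]) cyl N k.
    apply/seteqP; split=> s; last by move=> [N _ [k kW]] /kW.
    move=> /oW [N NW]; exists N => //; exists (code s N) => // t.
    by move=> /esym/codeP; exact: NW.
  pose T := g_sigma_algebraType cyls.
  suff : @measurable _ T (\bigcup_N \bigcup_(k in [set k | cyl N k `<=` W]) cyl N k).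
    by [].
  apply: bigcup_measurable => N _; apply: bigcup_measurable => k _.
  by apply: sub_sigma_algebra; exists N, k.
move=> _ [N [k ->]]; apply: sub_sigma_algebra; exact: cyl_open.
Qed.

Lemma cyl_measurable N k : measurable (cyl N k : set CB).
Proof. by rewrite measurable_CB; apply: sub_sigma_algebra; exists N, k. Qed.

Lemma cyl_mono N M s t : (N <= M)%N -> code s M = code t M -> code s N = code t N.
Proof.
by move=> NM /codeP st; apply/codeP => i iN; apply: st; exact: leq_trans NM.
Qed.

Lemma cyls_setI : setI_closed cyls.
Proof.
suff h N k M l : (N <= M)%N -> cyls (cyl N k `&` cyl M l).
  move=> _ _ [N [k ->]] [M [l ->]]; have [|/ltnW] := leqP N M; first exact: h.
  by rewrite setIC; exact: h.
move=> NM; have [[s [sk sl]]|no] := pselect (cyl N k `&` cyl M l !=set0).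
  exists M, l; apply/seteqP; split=> [t []//|t tl]; split=> //.
  by rewrite /cyl /= -sk; apply: cyl_mono NM _; rewrite tl.
exists 0%N, 1%N; apply/seteqP; split=> t; last by [].
by move=> tkl; case: no; exists t.
Qed.

(** * Binary digits of a uniform real number *)

Section Digits.
Variable R : realType.
Implicit Types y : R.

(** All digits are 0 outside of [[0, 1[], which makes [dig] a total measurable
    function. *)
Definition dig y : cantor_space :=
  fun i => (0 <= y < 1) && odd (Num.truncn (2 ^+ i.+1 * y)).

Lemma code_dig y N : 0 <= y < 1 -> code (dig y) N = Num.truncn (2 ^+ N * y).
Proof.
move=> y01; have y0 : 0 <= y by case/andP: y01.
have p0 M : 0 <= 2 ^+ M * y by rewrite mulr_ge0 ?exprn_ge0.
elim: N => [|N IH] /=.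
  by rewrite expr0 mul1r; apply/esym/eqP; rewrite truncn_eq.
rewrite IH /dig y01 /=; set k := Num.truncn (2 ^+ N.+1 * y).
suff -> : Num.truncn (2 ^+ N * y) = k./2 by rewrite addnC odd_double_half.
have /andP[k1 k2] := truncn_itv (p0 N.+1); rewrite -/k in k1 k2.
apply: truncn_def; move: k1 k2; rewrite -{1 2}(odd_double_half k) exprS.
rewrite -muln2 -!natr1 !natrD !natrM -mulrA.
by case: (odd k) => /=; move: (2 ^+ N * y) ((k./2)%:R : R) => a b; lra.
Qed.

Lemma dig_cylE N k : (k < 2 ^ N)%N ->
  [set y | dig y \in cyl N k] `&` `[0, 1[%classic =
  `[k%:R / 2 ^+ N, k.+1%:R / 2 ^+ N[%classic.
Proof.
move=> kN; have p0 : 0 < 2 ^+ N :> R by rewrite exprn_gt0.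
have kN1 : k.+1%:R <= 2 ^+ N :> R by rewrite -natrX ler_nat.
apply/seteqP; split=> y /=; rewrite inE !in_itv /= /cyl /=.
  move=> [ke y01]; move: ke; rewrite code_dig // => /eqP.
  rewrite truncn_eq; last by case/andP: y01 => y0 _; rewrite mulr_ge0 // ltW.
  by rewrite ler_pdivrMr // ltr_pdivlMr // mulrC.
rewrite ler_pdivrMr // ltr_pdivlMr // => /andP[ky yk].
have y0 : 0 <= y.
  by rewrite -(pmulr_lge0 _ p0) (le_trans _ ky).
have y1 : y < 1.
  by rewrite -(ltr_pM2r p0) mul1r (lt_le_trans yk).
rewrite y0 y1; split=> //; rewrite code_dig ?y0 ?y1 //.
by apply: truncn_def; rewrite mulrC ky.
Qed.

Lemma measurable_dig : measurable_fun setT (dig : R -> CB).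
Proof.
apply: (measurability _ measurable_CB) => _ [_ [N [k ->]] <-]; rewrite setTI.
rewrite -[X in measurable X]setIT -(setUv `[0, 1[%classic) setIUr.
apply: measurableU.
  have [kN|kN] := ltnP k (2 ^ N).
    rewrite (_ : _ `&` _ = `[k%:R / 2 ^+ N, k.+1%:R / 2 ^+ N[%classic) //.
    rewrite -dig_cylE //; congr (_ `&` _); apply/seteqP; split=> y /=.
      by rewrite inE.
    by rewrite inE.
  rewrite (_ : _ `&` _ = set0) //; apply/seteqP; split=> y //= -[yk _].
  by have := code_lt (dig y) N; rewrite yk ltnNge kN.
have [k0|k0] := eqVneq k (code (fun=> false) N).
  rewrite (_ : _ `&` _ = ~` `[0, 1[%classic); first exact: measurableC.
  apply/seteqP; split=> y //=; first by case.
  rewrite in_itv /= => y01; split=> //; rewrite k0 /cyl /=; apply/codeP => i _.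
  by rewrite /dig; case: (_ <= _ < _) y01.
rewrite (_ : _ `&` _ = set0) //; apply/seteqP; split=> y //= -[yk].
rewrite in_itv /= => y01; move/eqP: k0; apply; rewrite -yk; apply/codeP => i _.
by rewrite /dig; case: (_ <= _ < _) y01.
Qed.

(** The law of the digits of a uniform real number gives equal masses to the
    cylinders defined by [N] digits. The isometries of the Cantor space permute
    these cylinders, which are stable under intersection and generate the Borel
    sets. *)
Lemma coin_tossing_ex : exists coin : probability CB R,
  forall tau : cantor_space -> cantor_space,
    (forall N s t, agree N s t <-> agree N (tau s) (tau t)) ->
    (forall s, exists t, tau t = s) ->
  forall B : set CB, measurable B -> coin (tau @^-1` B) = coin B.
Proof.
have mI : measurable (`[0, 1[%classic : set R) by exact: measurable_itv.
pose coin : {measure set CB -> \bar R} :=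
  pushforward_measure (mrestr lebesgue_measure mI) measurable_dig.
have coin1 : coin setT = 1%E.
  rewrite /coin /= /pushforward /mrestr preimage_setT setTI.
  by rewrite lebesgue_measure_itv /= lte_fin ltr01 -EFinD subr0.
pose pcoin := mass1_probability coin1.
have coin_cyl N s : coin (cyl N (code s N)) = ((2 ^- N)%R : R)%:E.
  rewrite /coin /= /pushforward /mrestr.
  rewrite (_ : _ `&` _ = `[(code s N)%:R / 2 ^+ N, (code s N).+1%:R / 2 ^+ N[%classic).
    rewrite lebesgue_measure_itv /= lte_fin ltr_pM2r ?invr_gt0 ?exprn_gt0 //.
    rewrite ltr_nat ltnSn -EFinD -mulrBl -natrB ?leqnSn // subSnn mul1r //.
  rewrite -dig_cylE ?code_lt //; congr (_ `&` _).
  by apply/seteqP; split=> y /=; rewrite inE.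
exists pcoin => tau tauP tau_surj.
have tau_cyl N t : tau @^-1` cyl N (code (tau t) N) = cyl N (code t N).
  apply/seteqP; split=> s; rewrite /cyl /= => /codeP st; apply/codeP.
    exact/(tauP N s t).2.
  exact/(tauP N s t).1.
have tau_cyl0 N k : (cyl N k = set0) \/ exists t, cyl N k = cyl N (code (tau t) N).
  have [[s sk]|no] := pselect (cyl N k !=set0); last first.
    by left; apply/seteqP; split=> // s sk; case: no; exists s.
  by have [t ts] := tau_surj s; right; exists t; rewrite ts sk.
have mtau : measurable_fun setT (tau : CB -> CB).
  apply: (measurability _ measurable_CB) => _ [_ [N [k ->]] <-]; rewrite setTI.
  have [->|[t ->]] := tau_cyl0 N k; first by rewrite preimage_set0.
  by rewrite tau_cyl; exact: cyl_measurable.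
pose coin' : {measure set CB -> \bar R} := pushforward_measure pcoin mtau.
move=> B mB; rewrite -[LHS]/(coin' B) -[RHS]/(coin B).
have cylT : cyl 0 0 = setT by apply/seteqP.
apply: (@measure_unique _ R CB cyls (fun=> setT) _ _ _ _ coin' coin) => //.
- exact: measurable_CB.
- exact: cyls_setI.
- by move=> _; exists 0%N, 0%N; rewrite cylT.
- by rewrite bigcup_const.
- move=> _ [N [k ->]]; have [->|[t ->]] := tau_cyl0 N k; first by rewrite !measure0.
  by rewrite -[LHS]/(coin (tau @^-1` cyl N (code (tau t) N))) tau_cyl !coin_cyl.
- by move=> _; rewrite [coin' _]coin1 ltry.
Qed.

End Digits.

(** * Compact orbits of the diagonal group *)

(** There is no cancellation in the extended reals: the sums over [l] consecutive
    terms are compared by moving the last term to the front. *)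
Lemma periodic_sum (R : realType) (Psi : int -> \bar R) (l : nat) (i : int) :
  (forall j, Psi (j + l%:Z) = Psi j) ->
  (\sum_(j < l) Psi (i + j%:Z)%R = \sum_(j < l) Psi j%:Z)%E.
Proof.
case: l => [|l] Pl; first by rewrite !big_ord0.
have step k : (\sum_(j < l.+1) Psi (k + 1 + j%:Z)%R = \sum_(j < l.+1) Psi (k + j%:Z)%R)%E.
  rewrite big_ord_recr [RHS]big_ord_recl /= addr0 addeC; congr (_ + _)%E.
    by rewrite -[RHS]Pl; congr Psi; lia.
  by apply: eq_bigr => j _; congr Psi; rewrite /bump /=; lia.
have [k ik] : exists k : nat, i = k%:Z \/ i = - k%:Z.
  by exists `|i|%N; lia.
case: ik => ->; elim: k {i} => [|k IH].
- by apply: eq_bigr => j _; rewrite add0r.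
- by rewrite -IH -[RHS]step; apply: eq_bigr => j _; congr Psi; lia.
- by apply: eq_bigr => j _; rewrite oppr0 add0r.
- by rewrite -IH -[LHS]step; apply: eq_bigr => j _; congr Psi; lia.
Qed.

Section OneUnits.
Variable F : fieldType.
Implicit Types (u : laurent F) (s t : cantor_space).

Fact one_unit_subproof s : bounded_below
  (fun n : int => if n is Posz k then (if k is i.+1 then (s i)%:R else 1) else 0 : F).
Proof. by exists 0 => -[]. Qed.
Definition one_unit s : laurent F := mk_laurent (one_unit_subproof s).

Lemma one_unit1 s : unit1 (one_unit s).
Proof. by apply: unit1P => // -[]. Qed.

Lemma one_unit_agree N s t :
  agree N s t <-> lge (N%:Z + 1) (one_unit s - one_unit t).
Proof.
split=> [st [[|i]|i] nN|st i iN]; rewrite ?lcoefB /= ?subrr //.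
  by rewrite st ?subrr //; lia.
have /eqP := st i.+1%:Z ltac:(lia).
rewrite lcoefB subr_eq0 /=; case: (s i) (t i) => -[] //=.
  by rewrite oner_eq0.
by rewrite eq_sym oner_eq0.
Qed.

Definition digits u : cantor_space := fun i => u i.+1%:Z != 0.

Hypothesis F01 : forall c : F, c = 0 \/ c = 1.

Lemma digitsK u : unit1 u -> one_unit (digits u) = u.
Proof.
move=> u1; apply: laurentP => -[[|i]|i] /=.
- by rewrite unit1_coef0.
- by rewrite /digits; case: eqVneq => [->//|/eqP/(two_nonzero F01) ->].
- by rewrite (unit1_ge u1).
Qed.

(** The multiplication by [u], read on the coefficients of the one-units. *)
Definition twist u s : cantor_space := digits (u * one_unit s).

Lemma one_unit_twist u s : unit1 u -> one_unit (twist u s) = u * one_unit s.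
Proof. by move=> u1; rewrite digitsK //; apply: unit1M (one_unit1 s). Qed.

Lemma twist_agree u N s t : unit1 u ->
  agree N s t <-> agree N (twist u s) (twist u t).
Proof.
move=> u1; rewrite !one_unit_agree !one_unit_twist // -mulrBr; split.
  by move=> st; rewrite -[_ + 1]add0r; apply: lgeM st; exact: unit1_ge.
exact: unit1_geM.
Qed.

Lemma one_unit_inj : injective one_unit.
Proof.
move=> s t st; apply/funext => i.
by have st1 : agree i.+1 s t; [apply/one_unit_agree; rewrite st subrr | exact: st1].
Qed.

Lemma twist_surj u s : unit1 u -> exists t, twist u t = s.
Proof.
move=> u1; exists (twist u^-1 s); apply: one_unit_inj.
rewrite !one_unit_twist //; last exact: unit1V.
by rewrite mulVKf // unit1_neq0.
Qed.

Definition orbit_map (x : Xinf F) (j : int) s : Xinf F := act (lT F j * one_unit s) x.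

Lemma orbit_map_continuous x j : continuous (orbit_map x j).
Proof.
have nz s : lT F j * one_unit s != 0.
  by rewrite mulf_neq0 ?lT_neq0 // unit1_neq0 //; exact: one_unit1.
apply/continuousP => W oW; apply/cantor_openP => s Ws.
have [N NW] := act_open oW (nz s) Ws.
exists `|N - j|%N => t /agree_sym /one_unit_agree st; apply: NW => //.
by rewrite -mulrBr; apply: lge_le (lgeTM st); lia.
Qed.

Lemma act_orbit_map x i j u s : unit1 u ->
  act (lT F i * u) (orbit_map x j s) = orbit_map x (i + j) (twist u s).
Proof.
move=> u1; rewrite /orbit_map -actM ?mulf_neq0 ?lT_neq0 ?unit1_neq0 //; last exact: one_unit1.
by rewrite one_unit_twist // lTD mulrACA.
Qed.

(** The stabilizer of [x] contains an element of order [l] at infinity. When [l] is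
    positive, the quotient of the diagonal group by this stabilizer is compact. *)
Definition periodic_by (l : nat) x :=
  exists2 u : laurent F, unit1 u & act (lT F l%:Z * u) x = x.

Lemma periodic_orbit_map l x : periodic_by l x ->
  exists2 u, unit1 u & forall j s, orbit_map x (j + l%:Z) s = orbit_map x j (twist u s).
Proof.
move=> [u u1 ux]; have u1' := unit1V u1; exists u^-1 => // j s.
have u0 := unit1_neq0 u1; have s0 := unit1_neq0 (one_unit1 s).
rewrite /orbit_map one_unit_twist // (_ : _ * one_unit s =
  (lT F j * (u^-1 * one_unit s)) * (lT F l%:Z * u)); last first.
  by rewrite lTD; field.
by rewrite actM ?ux ?mulf_neq0 ?lT_neq0 ?invr_neq0.
Qed.

(** Up to the stabilizer, the order of an element of the diagonal group can be
    reduced modulo [l]. *)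
Lemma Aorbit_orbit_map l x : (0 < l)%N -> periodic_by l x ->
  Aorbit x = \bigcup_(j < l) range (orbit_map x j%:Z).
Proof.
move=> l0 /periodic_orbit_map [u u1 ux].
have shift j s : exists t, orbit_map x (j + l%:Z) t = orbit_map x j s.
  by have [t <-] := twist_surj s u1; exists t.
have shiftk k j s : exists t,
    orbit_map x (j + k * l%:Z) t = orbit_map x j s.
  have [m km] : exists m : nat, k = m%:Z \/ k = - m%:Z by exists `|k|%N; lia.
  case: km => ->; elim: m {k} j s => [|m IH] j s.
  - by exists s; rewrite mul0r addr0.
  - have [t <-] := IH j s; have [t' <-] := shift (j + m%:Z * l%:Z) t; exists t'.
    by rewrite (_ : j + m.+1%:Z * l%:Z = j + m%:Z * l%:Z + l%:Z) //; lia.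
  - by exists s; rewrite oppr0 mul0r addr0.
  - have [t <-] := IH j s; exists (twist u t); rewrite -ux.
    by rewrite (_ : _ + l%:Z = j + - m%:Z * l%:Z) //; lia.
rewrite AorbitE; apply/seteqP; split=> y.
  move=> [c c0 <-]; have [j [v [v1 ->]]] := laurent_polar F01 c0.
  have l0' : l%:Z != 0 by lia.
  have [t tE] := shiftk (- (j %/ l)%Z) j (digits v).
  have jl : (j %% l)%Z = `|(j %% l)%Z|%N%:Z by rewrite gez0_abs // modz_ge0.
  exists `|(j %% l)%Z|%N; first by have := ltz_pmod j (_ : 0 < l%:Z); rewrite /=; lia.
  have <- : orbit_map x j (digits v) = act (lT F j * v) x.
    by rewrite /orbit_map digitsK.
  exists t => //; rewrite -jl -tE.
  by rewrite (_ : j + _ = (j %% l)%Z) //; have := divz_eq j l; lia.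
move=> [j _ [s _ <-]]; exists (lT F j%:Z * one_unit s) => //=.
by rewrite mulf_neq0 ?lT_neq0 ?unit1_neq0 //; exact: one_unit1.
Qed.

Lemma periodic_compact l x : (0 < l)%N -> periodic_by l x -> A_periodic x.
Proof.
move=> l0 px; rewrite /A_periodic (Aorbit_orbit_map l0 px) bigcup_mkord.
apply: bigsetU_compact => j _; apply: continuous_compact cantor_space_compact.
exact/continuous_subspaceT/orbit_map_continuous.
Qed.

End OneUnits.

Section OrbitMeasures.
Variables (R : realType) (F : fieldType).
Hypothesis F01 : forall c : F, c = 0 \/ c = 1.
Implicit Types x : Xinf F.

Lemma continuous_Xborel (f : cantor_space -> Xinf F) :
  continuous f -> measurable_fun setT (f : CB -> Xborel F).
Proof.
move=> /continuousP cf; apply: (@measurability _ _ CB (Xborel F) setT f (@open (Xinf F))) => // _ [W oW <-].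
by rewrite setTI; apply: sub_sigma_algebra; exact: cf.
Qed.

(** The measure averages the images of the coin tossing measure by the maps
    [orbit_map x j] over one period. It is invariant as the one-units act by
    isometries on the Cantor space of their coefficients, and as shifting [j]
    permutes the terms of the average. The second property bounds the mass of a
    set by the proportion of the pieces of the orbit that meet it. *)
Lemma orbit_measure_ex l x : (0 < l)%N -> periodic_by l x ->
  exists m : probability (Xborel F) R, orbit_measure x m /\
    forall (B : set (Xborel F)) (P : {pred 'I_l}), measurable B ->
      (forall j s, j \notin P -> ~ B (orbit_map x j%:Z s)) ->
    (m B <= (#|P|%:R / l%:R)%:E)%E.
Proof.
move=> l0 px; have [coin coinP] := coin_tossing_ex R.
have mo j := continuous_Xborel (orbit_map_continuous (x := x) (j := j)).
have l0' : 0 < (l%:R : R)^-1 by rewrite invr_gt0 ltr0n.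
pose Psi (B : set (Xborel F)) (j : int) := coin (orbit_map x j @^-1` B).
have Psi_tw (B : set (Xborel F)) i j u : unit1 u -> measurable B ->
    Psi (act (lT F i * u) @^-1` B) j = Psi B (i + j).
  move=> u1 mB; rewrite /Psi -[RHS](coinP (twist u)) //.
  - by congr (coin _); apply/funext => s; rewrite /= act_orbit_map.
  - by move=> N s t; exact: twist_agree.
  - by move=> s; exact: twist_surj.
  - by rewrite -[X in measurable X]setTI; exact: mo.
have Psi_per (B : set (Xborel F)) j : measurable B -> Psi B (j + l%:Z) = Psi B j.
  move=> mB; have [u u1 ux] := periodic_orbit_map F01 px.
  rewrite /Psi -[RHS](coinP (twist u)) //.
  - by congr (coin _); apply/funext => s; rewrite /= ux.
  - by move=> N s t; exact: twist_agree.
  - by move=> s; exact: twist_surj.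
  - by rewrite -[X in measurable X]setTI; exact: mo.
pose m0 : {measure set (Xborel F) -> \bar R} :=
  mscale (NngNum (ltW l0')) (msum (fun j => pushforward_measure coin (mo j%:Z)) l).
have m0E B : m0 B = ((l%:R)^-1%:E * \sum_(j < l) Psi B j%:Z)%E by [].
have Psi1 B : (forall j s, B (orbit_map x j s)) -> m0 B = 1%E.
  move=> Bx; rewrite m0E (eq_bigr (fun=> 1%E)) => [|j _]; last first.
    rewrite /Psi (_ : _ @^-1` _ = setT) ?probability_setT //.
    by apply/seteqP; split=> // s _; exact: Bx.
  by rewrite sumEFin sumr_const card_ord -EFinM mulVf // pnatr_eq0 -lt0n.
exists (mass1_probability (Psi1 setT (fun _ _ => I))); split; [split|].
- apply: Psi1 => j s; rewrite AorbitE.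
  exists (lT F j * one_unit F s) => //=.
  by rewrite mulf_neq0 ?lT_neq0 ?unit1_neq0 //; exact: one_unit1.
- move=> a B /diag_act [c c0 ac] mB; rewrite -[LHS]/(m0 _) -[RHS]/(m0 _).
  have [i [u [u1 cE]]] := laurent_polar F01 c0.
  rewrite (_ : Xact a @^-1` B = act (lT F i * u) @^-1` B); last first.
    by rewrite -cE; apply/seteqP; split=> y /=; rewrite ac.
  rewrite !m0E -(periodic_sum i (fun j => Psi_per B j mB)); congr (_ * _)%E.
  by apply: eq_bigr => j _; rewrite Psi_tw.
- move=> B P mB BP; rewrite -[X in (X <= _)%E]/(m0 B) m0E mulrC EFinM.
  rewrite lee_pmul2l ?lte_fin //.
  rewrite -sumr_const -sumEFin [leRHS]big_mkcond /=.
  apply: lee_sum => j _; case: ifPn => [_|jP].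
    by apply: probability_le1; rewrite -[X in measurable X]setTI; apply: (mo j%:Z).
  rewrite /Psi (_ : _ @^-1` _ = set0) ?measure0 //.
  by apply/seteqP; split=> // s /(BP _ _ jP).
Qed.

End OrbitMeasures.

(** * Escape of mass *)

Section EscapeOfMass.
Variables (R : realType) (F : fieldType).
Implicit Types (mu : probability (Xborel F) R) (h : int).

Lemma thick_measurable h : measurable (~` shortX h : set (Xborel F)).
Proof. by apply: sub_sigma_algebra; exact: shortX_closed. Qed.

(** The support of [f] avoids a neighbourhood of the cusp, and [f] is bounded. *)
Lemma Cc_Rintegral (f : Xinf F -> R) : Cc f -> exists h (M : R),
  forall mu, `|\int[mu]_x f x| <= M * fine (mu (~` shortX h)).
Proof.
move=> [cf cC]; set C := closure _ in cC.
have [h Ch] := compact_shortX cC; exists h; pose V := (~` shortX h : set (Xborel F)).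
have mV : measurable V by exact: thick_measurable.
have mf : measurable_fun setT (f : Xborel F -> R).
  apply: (measurability _ (RGenOpens.measurableE R)) => _ [W [a [b ->]] <-].
  rewrite setTI; apply: sub_sigma_algebra.
  by move/continuousP: cf; apply; exact: interval_open.
have [M [_ /(_ (`|M| + 1)) fM]] : bounded_set (f @` C).
  by apply: compact_bounded; apply: continuous_compact => //; exact: continuous_subspaceT.
have f0 x : ~ V x -> f x = 0.
  move=> Vx; apply: contrapT => fx0; apply/Vx/Ch; exact: subset_closure.
have fM' x : `|f x| <= `|M| + 1.
  have [Cx|Cx] := pselect (C x).
    apply: fM; last by exists x.
    by rewrite (le_lt_trans (ler_norm M)) // ltrDl.
  suff -> : f x = 0 by rewrite normr0 addr_ge0.
  by apply: contrapT => fx0; apply/Cx/subset_closure.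
exists (`|M| + 1) => mu.
have -> : \int[mu]_x f x = \int[mu]_(x in V) f x.
  rewrite [RHS]Rintegral_mkcond; congr Rintegral; apply/funext => x.
  by rewrite patchE; case: ifPn => // /negP; rewrite inE => /f0.
have intf : mu.-integrable V (EFin \o f).
  apply: measurable_bounded_integrable => //.
  - by rewrite (le_lt_trans (probability_le1 _ _)) ?ltry.
  - exact: measurable_funS mf.
  - by exists (`|M| + 1); split; [rewrite num_real | move=> y My x _; apply: le_trans (fM' x) (ltW My)].
apply: le_trans (le_normr_Rintegral mV intf) _.
rewrite -Rintegral_cst //; apply: le_Rintegral => //.
- exact: integrable_norm.
- apply: measurable_bounded_integrable => //.
    by rewrite (le_lt_trans (probability_le1 _ _)) ?ltry.
  by exists (`|M| + 1); split; [rewrite num_real | move=> y My x _ /=; rewrite ger0_norm ?addr_ge0 //; exact: ltW].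
Qed.

(** Along the subsequence the integral of any function with compact support tends
    to 0, as only the mass outside a neighbourhood of the cusp contributes. *)
Lemma escape_weak_star (mu : nat -> probability (Xborel F) R) (n_ : nat -> nat) :
    (forall k, (k <= n_ k)%N) ->
    (forall h, (fun k => fine (mu (n_ k) (~` shortX h))) @ \oo --> (0 : R)) ->
  weak_star_accumulation mu (@mzero _ (Xborel F) R).
Proof.
move=> n_ge mu0; split; first by move=> C _; rewrite /mzero ltry.
have cvg0 : (fun k => functional (mu (n_ k))) @ \oo --> functional (@mzero _ (Xborel F) R).
  apply: ptws_cvg => f; have [h [M fM]] := Cc_Rintegral (set_valP f).
  rewrite {2}/functional /Rintegral integral_measure_zero /=.
  apply: norm_cvg0; apply: (@squeeze_cvgr _ _ _ _ (fun=> 0)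
    (fun k => M * fine (mu (n_ k) (~` shortX h)))); last 2 first.
  - exact: cvg_cst.
  - by rewrite -(mulr0 M); apply: cvgMr; exact: mu0.
  by apply: nearW => k; rewrite normr_ge0 fM.
move=> A B [N _ NA] /cvg0 [K _ KB].
exists (functional (mu (n_ (maxn N K)))); split.
  by apply: NA => /=; rewrite (leq_trans _ (n_ge _)) ?leq_maxl.
by apply: KB => /=; exact: leq_maxr.
Qed.

End EscapeOfMass.

(** * Integers of the completion *)

Section CompletionRing.
Local Open Scope quotient_scope.
Variables (K : fieldType) (v : valuation K).
Local Notation Q := {ideal_quot (@null_ideal K v : idealr (cauchy_seq v))}.
Implicit Types s t : cauchy_seq v.

Lemma completion_ringP s : completion_ring (\pi_Q s : completion v) <->
  exists N, forall i, (N <= i)%N -> vge v 0 (s i).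
Proof.
split; last by move=> h; exists s.
move=> [t /eqP]; rewrite -[_ == _]/(_ == _ :> Q) piE Quotient.equivE.
move=> /asboolP st [M tM]; have [N stN] := st 0.
exists (maxn M N) => i; rewrite geq_max => /andP[Mi Ni].
by rewrite -(subrK (t i) (s i)); apply: vgeD; [exact: stN | exact: tM].
Qed.

Lemma completion_ringM (x y : completion v) :
  completion_ring x -> completion_ring y -> completion_ring (x * y).
Proof.
move=> [s -> [N sN]] [t -> [M tM]]; rewrite -[_ * _]/(\pi_Q s * \pi_Q t) -rmorphM.
apply/completion_ringP; exists (maxn N M) => i; rewrite geq_max => /andP[Ni Mi].
by rewrite -[0]addr0; apply: vgeM; [exact: sN | exact: tM].
Qed.

Lemma completion_ringD (x y : completion v) :
  completion_ring x -> completion_ring y -> completion_ring (x + y).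
Proof.
move=> [s -> [N sN]] [t -> [M tM]]; rewrite -[_ + _]/(\pi_Q s + \pi_Q t) -rmorphD.
apply/completion_ringP; exists (maxn N M) => i; rewrite geq_max => /andP[Ni Mi].
by apply: vgeD; [exact: sN | exact: tM].
Qed.

Lemma to_completion_ring (x : K) :
  completion_ring (to_completion v x) <-> vge v 0 x.
Proof.
split=> [/completion_ringP [N /(_ N (leqnn N))] //|x0].
by apply/completion_ringP; exists 0%N.
Qed.

(** A Cauchy sequence is bounded, so a power of [x] is a denominator for it. *)
Lemma completion_ring_scale (x : K) (z : completion v) : 0 < v x ->
  x != 0 -> exists m, completion_ring (to_completion v x ^+ m * z).
Proof.
move=> vx x0; elim/quotW: z => s.
have [b [N sN]] := cauchy_bounded (asboolW (cseqP s)).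
exists `|b|%N; rewrite -rmorphXn -[_ * _]/(\pi_Q _ * \pi_Q s) -rmorphM.
apply/completion_ringP; exists N => i /sN sb.
have vxm m : x ^+ m != 0 /\ m%:Z <= v (x ^+ m).
  elim: m => [|m [xm IH]]; first by rewrite expr0 oner_neq0 vfun1.
  by rewrite exprS mulf_neq0 // vfunM //; split=> //; lia.
rewrite -[cseq _ i]/(x ^+ `|b|%N * s i) -(subrr `|b|%N%:Z).
apply: vgeM; first by rewrite /vge (vxm _).2 orbT.
by apply: vge_le sb; lia.
Qed.

End CompletionRing.

Section NuAdicIntegers.
Variables (F : fieldType) (nu : prime_poly F).
Implicit Types p : {poly F}.
Local Notation K := {fraction {poly F}}.

Lemma poly_KnuE p : poly_Knu nu p = to_completion (nu_valuation nu) (FracField.tofrac p).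
Proof. by []. Qed.

Lemma poly_KnuD p q : poly_Knu nu (p + q) = poly_Knu nu p + poly_Knu nu q.
Proof. by rewrite !poly_KnuE !rmorphD. Qed.

Lemma poly_KnuM p q : poly_Knu nu (p * q) = poly_Knu nu p * poly_Knu nu q.
Proof. by rewrite !poly_KnuE !rmorphM. Qed.

Lemma poly_KnuX p n : poly_Knu nu (p ^+ n) = poly_Knu nu p ^+ n.
Proof. by rewrite !poly_KnuE !rmorphXn. Qed.

Lemma poly_Knu0 : poly_Knu nu 0 = 0.
Proof. by rewrite poly_KnuE !rmorph0. Qed.

Lemma poly_KnuN p : poly_Knu nu (- p) = - poly_Knu nu p.
Proof. by rewrite !poly_KnuE !rmorphN. Qed.

Lemma poly_Knu1 : poly_Knu nu 1 = 1.
Proof. by rewrite poly_KnuE !rmorph1. Qed.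

Lemma poly_Knu_eq0 p : (poly_Knu nu p == 0) = (p == 0).
Proof. by rewrite poly_KnuE fmorph_eq0 tofrac_eq0. Qed.

Lemma nu_val_poly p : p != 0 -> nu_val nu (FracField.tofrac p) = (nu_ord nu p)%:Z.
Proof.
move=> p0; rewrite (_ : FracField.tofrac p =
  FracField.tofrac p / FracField.tofrac 1); last by rewrite rmorph1 divr1.
rewrite nu_valE ?oner_neq0 // (@ordE _ nu 1 1 0) ?subr0 ?expr0 ?mul1r //.
by rewrite dvdp1; have [sz _] := prime_polyP nu; rewrite gtn_eqF.
Qed.

Lemma Onu_poly p : Onu (poly_Knu nu p).
Proof.
apply/to_completion_ring; rewrite /vge tofrac_eq0.
by have [//|p0] := eqVneq p 0; rewrite /= [X in _ <= X]nu_val_poly.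
Qed.

(** A polynomial which is a multiple of [nu^n] in the completed local ring is so
    among polynomials. *)
Lemma Onu_dvd n p z : Onu (nu := nu) z ->
  poly_Knu nu p = poly_Knu nu nu ^+ n * z -> (nu : {poly F}) ^+ n %| p.
Proof.
move=> zO pz; have [->|p0] := eqVneq p 0; first exact: dvdp0.
have nn0 : (nu : {poly F}) ^+ n != 0 by rewrite expf_neq0 // prime_poly_neq0.
have zE : z = to_Knu nu (FracField.tofrac p / FracField.tofrac ((nu : {poly F}) ^+ n)).
  have nu0 : poly_Knu nu nu ^+ n != 0 by rewrite -poly_KnuX poly_Knu_eq0.
  apply: (mulfI nu0); rewrite -pz mulrC -poly_KnuX !poly_KnuE -rmorphM.
  by rewrite divfK // tofrac_eq0.
move: zO; rewrite zE => /to_completion_ring.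
rewrite /vge mulf_eq0 invr_eq0 !tofrac_eq0 (negPf p0) (negPf nn0) /=.
rewrite [X in _ <= X]nu_valE // ord_dvd // (@ordE _ nu ((nu : {poly F}) ^+ n) 1 n) ?mulr1 //; last first.
  by rewrite dvdp1; have [sz _] := prime_polyP nu; rewrite gtn_eqF.
by rewrite subr_ge0.
Qed.

End NuAdicIntegers.

(** * Lattices along a ray *)

Lemma det2_congr (R : comNzRingType) (a b s t N c d e f : R) :
  (s * a + N * c) * (t * b + N * d) - (t * a + N * f) * (s * b + N * e) =
  N * (s * (a * d) + t * (b * c) + N * (c * d) - (s * (b * f) + t * (a * e) + N * (e * f))).
Proof. by ring. Qed.

Section Sublattices.
Variables (F : fieldType) (nu : prime_poly F).
Implicit Types (ab : 'cV[Knu nu]_2) (n : nat) (u : 'cV[{poly F}]_2).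

Lemma OnuM (x y : Knu nu) : Onu x -> Onu y -> Onu (x * y).
Proof. exact: completion_ringM. Qed.

Lemma OnuD (x y : Knu nu) : Onu x -> Onu y -> Onu (x + y).
Proof. exact: completion_ringD. Qed.

Lemma OnuB (x y : Knu nu) : Onu x -> Onu y -> Onu (x - y).
Proof.
move=> xO yO; rewrite -mulN1r -poly_Knu1 -poly_KnuN.
by apply: OnuD => //; apply: OnuM => //; exact: Onu_poly.
Qed.

Lemma Onu0 : Onu (0 : Knu nu).
Proof. by rewrite -poly_Knu0; exact: Onu_poly. Qed.

Lemma sublatticeD ab n u u' :
  sublattice ab n u -> sublattice ab n u' -> sublattice ab n (u + u').
Proof.
move=> [t [w [tO wO uE]]] [t' [w' [tO' wO' uE']]]; exists (t + t'), (w + w').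
split; [exact: OnuD | by move=> i; rewrite mxE; exact: OnuD |].
rewrite scalerDl scalerDr addrACA -uE -uE'.
by apply/matrixP => i j; rewrite !mxE poly_KnuD.
Qed.

Lemma sublatticeZ ab n p u : sublattice ab n u -> sublattice ab n (p *: u).
Proof.
move=> [t [w [tO wO uE]]]; exists (poly_Knu nu p * t), (poly_Knu nu p *: w).
have pO := Onu_poly nu p.
split; [exact: OnuM | by move=> i; rewrite mxE; exact: OnuM |].
apply/matrixP => i j; have /matrixP/(_ i j) := uE; rewrite !mxE poly_KnuM => ->.
by rewrite mulrDr mulrA [in X in _ + X = _]mulrCA.
Qed.

Lemma sublattice_pow ab n u : sublattice ab n ((nu : {poly F}) ^+ n *: u).
Proof.
exists 0, (map_mx (poly_Knu nu) u); split; first exact: Onu0.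
  by move=> i; rewrite mxE; exact: Onu_poly.
by apply/matrixP => i j; rewrite !mxE mul0r add0r poly_KnuM poly_KnuX.
Qed.

Lemma sublattice0 ab u : sublattice ab 0 u.
Proof. by rewrite -[u]scale1r -(expr0 (nu : {poly F})); exact: sublattice_pow. Qed.

(** Two vectors of the lattice are collinear modulo [nu^n]; this bounds its covolume
    from below. *)
Lemma sublattice_det ab n (W : 'M[{poly F}]_2) : (forall i, Onu (ab i 0)) ->
  (forall j, sublattice ab n (col j W)) -> (nu : {poly F}) ^+ n %| \det W.
Proof.
move=> abO WL; rewrite det2.
have [s [w [sO wO wE]]] := WL 0; have [t [w' [tO wO' wE']]] := WL 1.
have e0 i : poly_Knu nu (W i 0) = s * ab i 0 + poly_Knu nu nu ^+ n * w i 0.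
  by have /matrixP/(_ i 0) := wE; rewrite !mxE.
have e1 i : poly_Knu nu (W i 1) = t * ab i 0 + poly_Knu nu nu ^+ n * w' i 0.
  by have /matrixP/(_ i 0) := wE'; rewrite !mxE.
have bO i : Onu (w i 0) by exact: wO.
have NO : Onu (poly_Knu nu nu ^+ n) by rewrite -poly_KnuX; exact: Onu_poly.
apply: Onu_dvd; last first.
  by rewrite poly_KnuD poly_KnuN !poly_KnuM !e0 !e1 det2_congr.
by apply: OnuB; repeat (apply: OnuD || apply: OnuM) => //.
Qed.

(** A rational line is spanned by a vector with polynomial coordinates. Up to a
    power of [nu], this vector is a multiple of the primitive coordinates by an
    element of the local ring, so that it belongs to all the lattices attached to
    the line. *)
Lemma sublattice_rational ab : rational_coords ab ->
  exists2 v : 'cV[{poly F}]_2, v != 0 & forall n, sublattice ab n v.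
Proof.
move=> [c [k [c0 k0 abE]]].
have frac (x : {fraction {poly F}}) : exists pq : {poly F} * {poly F},
    pq.2 != 0 /\ x = FracField.tofrac pq.1 / FracField.tofrac pq.2.
  have [->|x0] := eqVneq x 0; first by exists (0, 1); rewrite oner_neq0 rmorph0 mul0r.
  by have [p [q [_ q0 xE _]]] := fraction_num nu x0; exists (p, q).
have /boolp.choice [d dP] := frac.
pose D := \prod_(i < 2) (d (k i 0)).2.
have D0 : D != 0 by apply/prodf_neq0 => i _; case: (dP (k i 0)).
have /boolp.choice [k' k'E] : forall i : 'I_2, exists p : {poly F},
    FracField.tofrac p = FracField.tofrac D * k i 0.
  move=> i; exists ((d (k i 0)).1 * \prod_(j < 2 | j != i) (d (k j 0)).2).
  have -> : D = (d (k i 0)).2 * \prod_(j < 2 | j != i) (d (k j 0)).2.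
    by rewrite /D (bigD1 i).
  rewrite !rmorphM; have [q0 kE] := dP (k i 0).
  by rewrite {3}kE [in RHS]mulrAC [in RHS]mulrCA divff ?tofrac_eq0 // mulr1.
have D0K : to_Knu nu (FracField.tofrac D) != 0 by rewrite -[to_Knu _ _]/(poly_Knu nu D) poly_Knu_eq0.
have nu1 : 0 < nu_valuation nu (FracField.tofrac (nu : {poly F})).
  rewrite [X in 0 < X]nu_val_poly ?prime_poly_neq0 //.
  by rewrite ltz_nat -(ord_dvd nu 1) ?prime_poly_neq0 // expr1 dvdpp.
have [m mO] := completion_ring_scale (to_Knu nu (FracField.tofrac D) / c) nu1
  ltac:(by rewrite tofrac_eq0 prime_poly_neq0).
pose v : 'cV[{poly F}]_2 := \col_i ((nu : {poly F}) ^+ m * k' i).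
exists v => [|n].
  apply: contraNneq k0 => v0; apply/eqP/matrixP => i j; rewrite ord1 mxE.
  have /matrixP/(_ i 0)/eqP := v0; rewrite !mxE mulf_eq0 expf_eq0.
  rewrite (negPf (prime_poly_neq0 nu)) andbF /= -tofrac_eq0 k'E mulf_eq0.
  by rewrite tofrac_eq0 (negPf D0) => /eqP.
exists (poly_Knu nu nu ^+ m * (to_Knu nu (FracField.tofrac D) / c)), 0.
split=> //; first by move=> i; rewrite mxE; exact: Onu0.
rewrite scaler0 addr0; apply/matrixP => i j; rewrite ord1 !mxE abE !mxE.
rewrite poly_KnuM poly_KnuX -[poly_Knu nu (k' i)]/(to_Knu nu (FracField.tofrac (k' i))).
rewrite k'E [to_Knu nu (_ * _)](rmorphM (to_completion (nu_valuation nu))).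
by rewrite -!mulrA mulKf.
Qed.

End Sublattices.

(** The columns of [W] form a basis of the lattice [L]; the matrix [c g'] of the
    class [x] is then [g W]. *)
Lemma lattice_matrix (F : fieldType) (g : GL2 F) L (x : Xinf F) :
  lattice_in_class (lattice_image g L) x ->
  exists g' c (W : 'M[{poly F}]_2), [/\ lat g' = x, c != 0,
    c *: \val g' = \val g *m pmx W & forall w, L w <-> exists u, w = W *m u].
Proof.
move=> [g' [c [c0 gx Lg]]].
have ginj : injective (fun u : 'cV[{poly F}]_2 => \val g *m pmx u).
  by move=> u w /(congr1 (mulmx (invmx (\val g)))); rewrite !mulKmx ?GL2_unit // => /pmx_inj.
have in_L (u : 'cV[{poly F}]_2) : exists2 w, L w & \val g *m pmx w = c *: (\val g' *m pmx u).
  have : [set c *: v | v in lattice_image g' setT] (c *: (\val g' *m pmx u)).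
    by exists (\val g' *m pmx u) => //; exists u.
  by rewrite -Lg => -[w Lw gw]; exists w.
have /boolp.choice [w wP] : forall j : 'I_2, exists w, L w /\
    \val g *m pmx w = c *: (\val g' *m pmx (delta_mx j 0)).
  by move=> j; have [w Lw gw] := in_L (delta_mx j 0); exists w.
pose W := \matrix_(i, j) w j i 0; exists g', c, W.
have WE : c *: \val g' = \val g *m pmx W.
  apply/trmx_inj/row_matrixP => j; rewrite -!tr_col; congr trmx.
  rewrite !colE -[in RHS]mulmxA -(map_delta_mx (@poly_laurent F)) -[in RHS]pmxM -scalemxAl.
  rewrite -(wP j).2; congr (_ *m pmx _).
  by apply/matrixP => i k; rewrite -colE !mxE ord1.
split=> // v; split=> [Lv|[u ->]].
  have : lattice_image g L (\val g *m pmx v) by exists v.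
  rewrite Lg => -[_ [u _ <-] gv]; exists u; apply: ginj.
  by rewrite pmxM mulmxA -WE -scalemxAl.
have [w' Lw gw] := in_L u; suff -> : W *m u = w' by [].
by apply: ginj; rewrite gw pmxM mulmxA -WE -scalemxAl.
Qed.

(** * The quadratic order *)

Section QuadraticOrder.
Variable F : fieldType.
Hypothesis F01 : forall c : F, c = 0 \/ c = 1.
Variable f : laurent F.
Hypotheses (f1 : lge 1 f) (fE : f = lT F 1 * (1 + f ^+ 2)).
Local Notation Y := (lT F (-1)).

(** The conjugate of [f]; it is also its inverse. *)
Definition bigroot := Y + f.

Lemma small_sqr : f ^+ 2 = Y * f + 1.
Proof.
rewrite [in RHS]fE mulrA -lTD addNr lT0 mul1r addrAC laurent_addff //.
by rewrite add0r.
Qed.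

Lemma big_sqr : bigroot ^+ 2 = Y * bigroot + 1.
Proof. by rewrite laurent_sqrD // small_sqr mulrDr addrA expr2. Qed.

Lemma bigrootM : bigroot * f = 1.
Proof.
rewrite mulrDl -expr2 small_sqr addrA laurent_addff //.
by rewrite add0r.
Qed.

(** The rational part of the [2^k]-th power of a root of [z^2 = Y z + 1]. *)
Fixpoint pow_rat k : {poly F} :=
  if k is m.+1 then pow_rat m ^+ 2 + 'X ^+ (2 ^ m.+1 - 2) else 0.

(** Iterating the Frobenius map on [z^2 = Y z + 1]: the power belongs to the order
    of conductor [Y^(2^k - 1)]. *)
Lemma root_pow z k : z ^+ 2 = Y * z + 1 ->
  z ^+ (2 ^ k) = poly_laurent (pow_rat k) + poly_laurent ('X ^+ (2 ^ k - 1)) * z.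
Proof.
move=> z2; elim: k => [|k IH].
  by rewrite expr1 subnn expr0 !rmorph1 rmorph0 add0r mul1r.
have k0 := expn_gt0 2 k.
have e2 : (2 ^ k.+1 - 2 = (2 ^ k - 1) * 2)%N by rewrite expnSr; lia.
have e1 : (2 ^ k.+1 - 1 = (2 ^ k - 1) * 2 + 1)%N by rewrite expnSr; lia.
rewrite -[pow_rat k.+1]/(pow_rat k ^+ 2 + 'X ^+ (2 ^ k.+1 - 2)) e2 e1.
rewrite expnSr exprM IH laurent_sqrD // exprMn z2.
rewrite exprD expr1 rmorphD [poly_laurent (_ * 'X)]rmorphM !exprM !rmorphXn /=.
rewrite poly_laurentX.
by rewrite mulrDr mulr1 mulrA [RHS]addrAC -addrA.
Qed.

(** The two embeddings at infinity of the order of basis [(1, eps)], where [eps] is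
    [bigroot]. *)
Definition g0_mx : 'M[laurent F]_2 :=
  \matrix_(i, j) if j == 0 then 1 else if i == 0 then bigroot else f.

Lemma g0_unit : g0_mx \in unitmx.
Proof.
rewrite unitmxE det2 !mxE /= mul1r mulr1 unitfE /bigroot opprD addrCA subrr addr0.
by rewrite oppr_eq0 lT_neq0.
Qed.
Definition g0 : GL2 F := mkGL2 g0_unit.

(** The matrix of the multiplication by [eps] in the basis [(1, eps)]. *)
Definition companion : 'M[{poly F}]_2 :=
  \matrix_(i, j) if i == 0 then (j != 0)%:R else if j == 0 then 1 else 'X.

Lemma g0_companion : g0_mx *m pmx companion = dmx bigroot f *m g0_mx.
Proof.
apply/matrixP => i j; rewrite dmxE !mxE !big_ord_recl big_ord0 addr0 !mxE /=.
have Ez z : z ^+ 2 = Y * z + 1 -> 1 + z * poly_laurent 'X = z * z.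
  by move=> z2; rewrite poly_laurentX -expr2 z2 addrC mulrC.
case: (i == 0); case: (j == 0) => /=; rewrite ?rmorph0 ?rmorph1 ?mul1r ?mulr1 ?mulr0 ?add0r //.
  exact: Ez big_sqr.
exact: Ez small_sqr.
Qed.

Lemma companion_conj (g : GL2 F) : lat g = lat g0 ->
  exists E : 'M[{poly F}]_2, \val g *m pmx E = dmx bigroot f *m \val g.
Proof.
move=> /esym/latP [c [u [c0 uu ->]]]; exists (invmx u *m (companion *m u)).
rewrite !pmxM -scalemxAl -!mulmxA (mulmxA (pmx u)) -pmxM mulmxV // pmx1 mul1mx.
by rewrite mulmxA [\val g0 *m _]g0_companion -mulmxA scalemxAr.
Qed.

(** The matrix of the multiplication by [eps^(2^k)], if [E] is that of the
    multiplication by [eps]. *)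
Definition unit_mx (E : 'M[{poly F}]_2) k : 'M[{poly F}]_2 :=
  (pow_rat k)%:M + 'X ^+ (2 ^ k - 1) *: E.

Lemma unit_mxE (G : 'M[laurent F]_2) E k : G *m pmx E = dmx bigroot f *m G ->
  G *m pmx (unit_mx E k) = dmx (bigroot ^+ (2 ^ k)) (f ^+ (2 ^ k)) *m G.
Proof.
move=> GE; have -> : pmx (unit_mx E k) = (poly_laurent (pow_rat k))%:M +
    poly_laurent ('X ^+ (2 ^ k - 1)) *: pmx E.
  by rewrite /pmx map_mxD map_mxZ map_scalar_mx.
rewrite mulmxDr mul_mx_scalar -scalemxAr GE; apply/matrixP => i j.
rewrite dmxE mxE [X in X + _]mxE [X in _ + X]mxE dmxE mulrA -mulrDl.
by case: ifP => _; congr (_ * _); rewrite root_pow //; [exact: big_sqr | exact: small_sqr].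
Qed.

Lemma small_pow m : exists2 w, unit1 w & f ^+ m = lT F m%:Z * w.
Proof.
have w1 : unit1 (1 + f ^+ 2).
  by rewrite /unit1 addrAC subrr add0r expr2; apply: lge_le (lgeM f1 f1).
elim: m => [|m [w ww IH]]; first by exists 1; rewrite ?lT0 ?mulr1 //; exact: unit1_1.
exists ((1 + f ^+ 2) * w); first exact: unit1M.
by rewrite exprS IH {1}fE mulrACA -lTD.
Qed.

Lemma small_pow_ge m : lge m%:Z (f ^+ m).
Proof.
have [w w1 ->] := small_pow m; rewrite -[X in lge X]addr0.
exact: lgeTM (unit1_ge w1).
Qed.

Lemma big_pow_ge m : lge (- m%:Z) (bigroot ^+ m).
Proof.
elim: m => [|m IH]; first exact: lge1.
have b1 : lge (-1) bigroot by apply: lgeD; [exact: lge_T | exact: lge_le f1].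
by rewrite exprS; apply: lge_le (lgeM b1 IH); lia.
Qed.

Lemma bigroot_pow m : bigroot ^+ m * f ^+ m = 1.
Proof. by rewrite -exprMn bigrootM // expr1n. Qed.

(** An integral endomorphism given by a unit of the quadratic order preserves
    covolumes, hence is an automorphism of any lattice it maps into itself. *)
Lemma periodic_lattice (g g' : GL2 F) (W M U : 'M[{poly F}]_2) c q :
    \val g *m pmx M = dmx (bigroot ^+ q) (f ^+ q) *m \val g ->
    c != 0 -> c *: \val g' = \val g *m pmx W -> M *m W = W *m U ->
  periodic_by (2 * q) (lat g').
Proof.
move=> gM c0 gW MW; have bf := bigroot_pow q.
have f0 : f ^+ q != 0 by apply: contra_eq_neq bf => ->; rewrite mulr0 eq_sym oner_neq0.
have b0 : bigroot ^+ q != 0.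
  by apply: contra_eq_neq bf => ->; rewrite mul0r eq_sym oner_neq0.
have gU : dmx (bigroot ^+ q) (f ^+ q) *m \val g' = \val g' *m pmx U.
  apply: (scalerI c0); rewrite scalemxAr gW mulmxA -gM -mulmxA -pmxM MW pmxM.
  by rewrite mulmxA -gW scalemxAl.
have Uu : U \in unitmx.
  have := congr1 (fun A => \det A) gU; rewrite !det_mulmx det_dmx bf mul1r det_pmx.
  rewrite -[LHS]mulr1 => /mulfI U1; rewrite unitmxE.
  suff -> : \det U = 1 by exact: unitr1.
  apply: (@poly_laurent_inj F); rewrite rmorph1 U1 //.
  by rewrite -unitfE -unitmxE GL2_unit.
have bb : bigroot ^+ (2 * q) = bigroot ^+ q * bigroot ^+ q.
  by rewrite mul2n -addnn exprD.
have actb : act (bigroot ^+ (2 * q)) (lat g') = lat g'.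
  rewrite act_lat; apply/esym/latP; exists (bigroot ^+ q), U; split=> //.
  rewrite -gU -[LHS]/(\val (dgl _) *m \val g') dglE ?bb ?mulf_neq0 //.
  apply/matrixP => i j; rewrite dmxE mxE dmxE mulrA.
  by case: ifP => // _; rewrite bf.
have [w w1 wE] := small_pow (2 * q); exists w => //.
rewrite -wE -{1}actb -actM ?bb ?mulf_neq0 //; last first.
  by rewrite mul2n -addnn exprD mulf_neq0.
by rewrite -bb mulrC bigroot_pow act1.
Qed.

(** The determinant of [W] is divisible by [Y^n], so the covolume of the lattice is
    at least [q^n] times that of the lattice of basis [g], while [m] bounds the
    norm of its vector [g W u] at time [j]. *)
Lemma short_act (g g' : GL2 F) (W : 'M[{poly F}]_2)
    (u : 'cV[{poly F}]_2) c d h m (n j : nat) p :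
    c != 0 -> c *: \val g' = \val g *m pmx W ->
    'X ^+ n %| \det W -> u != 0 -> unit1 p ->
    lge d (\det (\val g)) -> (\det (\val g)) d != 0 ->
    mx_ge m (dmx (lT F j%:Z * p) 1 *m (\val g *m pmx (W *m u))) ->
    j%:Z + d + h <= n%:Z + m + m ->
  shortX h (act (lT F j%:Z * p) (lat g')).
Proof.
move=> c0 gW Wn u0 p1 gd gd0 um jn; rewrite act_lat; apply/shortXP.
have p0 : lT F j%:Z * p != 0 by rewrite mulf_neq0 ?lT_neq0 ?unit1_neq0.
rewrite -[\val (_ * g')%g]/(\val (dgl _) *m \val g') dglE //.
apply: (short_scale c0); rewrite scalemxAr gW; exists u, m; split=> //.
  by rewrite -!mulmxA -pmxM.
have W0 : \det W != 0.
  have : \det (c *: \val g') != 0.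
    by rewrite detZ mulf_neq0 ?expf_neq0 // -unitfE -unitmxE GL2_unit.
  rewrite gW det_mulmx det_pmx mulf_eq0 negb_or => /andP[_].
  by apply: contraNneq => ->; rewrite rmorph0.
have Wsz : (n < size (\det W))%N by have := dvdp_leq W0 Wn; rewrite size_polyXn.
rewrite !det_mulmx det_dmx mulr1 det_pmx => dW; apply: (poly_lge_size Wsz).
have pj : lge j%:Z (lT F j%:Z * p).
  by rewrite -[X in lge X]addr0; apply: lgeTM (unit1_ge p1).
have pj0 : (lT F j%:Z * p) j%:Z != 0 by rewrite lcoefTM subrr unit1_coef0 // oner_neq0.
apply: (lgeMK gd gd0); apply: (lgeMK pj pj0); apply: lge_le dW; lia.
Qed.

(** At time [j], that is after the action of an element of order [j], the first
    coordinate of [v] has been multiplied by an element of order [j]: [v] is short in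
    a lattice of covolume at least about [q^(n - j)], for [j] up to about
    [n = 2^k - 1]. Then comes the turn of [eps^(2^k) v], whose coordinates have
    orders shifted by [- 2^k] and [2^k], up to the end of the period [2^(k+1)]. *)
Lemma escape_window (g : GL2 F) (E : 'M[{poly F}]_2) (v : 'cV[{poly F}]_2) h :
    \val g *m pmx E = dmx bigroot f *m \val g -> v != 0 ->
  exists C : nat, forall k (g' : GL2 F) c (W : 'M[{poly F}]_2),
    c != 0 -> c *: \val g' = \val g *m pmx W -> 'X ^+ (2 ^ k - 1) %| \det W ->
    (exists u, v = W *m u) -> (exists u, unit_mx E k *m v = W *m u) ->
  forall (j : nat) p, (j < 2 * 2 ^ k)%N -> unit1 p ->
    ~ (2 ^ k <= j + C /\ j <= 2 ^ k + C)%N ->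
  shortX h (act (lT F j%:Z * p) (lat g')).
Proof.
move=> gE v0; have [a ga] := mx_ge_ex (\val g *m pmx v).
have /laurent_lead [d [gd0 gd]] : \det (\val g) != 0.
  by rewrite -unitfE -unitmxE GL2_unit.
(* [a] is a lower bound on the orders of the coordinates of [v],
   and [d] the order of the determinant of [g] *)
exists (`|(d + h - a - a)%R|%N + 1)%N => k g' c W c0 gW Wn [u vu] [u' vu'] j p jk p1 jC.
have k0 := expn_gt0 2 k.
have u0 : u != 0 by apply: contraNneq v0 => u0; rewrite vu u0 mulmx0.
have gMv : \val g *m pmx (unit_mx E k *m v) =
    dmx (bigroot ^+ (2 ^ k)) (f ^+ (2 ^ k)) *m (\val g *m pmx v).
  by rewrite pmxM !mulmxA unit_mxE.
have bf := bigroot_pow (2 ^ k).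
have u0' : u' != 0.
  apply: contraNneq v0 => u0'; apply/eqP/(@pmx_inj F).
  apply: (can_inj (mulKmx (GL2_unit g))); apply/matrixP => i i'.
  have /matrixP/(_ i i')/esym/eqP := gMv.
  rewrite vu' u0' mulmx0 /pmx !map_mx0 !mulmx0 dmxE !mxE mulf_eq0 => /orP[|/eqP->//].
  have := oner_eq0 (laurent F); rewrite -bf mulf_eq0 => /norP[b0 f0].
  by case: ifP => _; rewrite ?(negPf b0) ?(negPf f0).
have pj : lge j%:Z (lT F j%:Z * p).
  by rewrite -[X in lge X]addr0; apply: lgeTM (unit1_ge p1).
have [jlow|jhigh] := leqP (j + (`|(d + h - a - a)%R| + 1)) (2 ^ k).
  apply: (short_act (m := a) c0 gW Wn u0 p1 gd gd0); last by lia.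
  move=> i i'; rewrite -vu dmxE; case: ifP => _; last by rewrite mul1r.
  by apply: lge_le (lgeM pj (ga i i')); lia.
apply: (short_act (m := a + j%:Z - (2 ^ k)%:Z) c0 gW Wn u0' p1 gd gd0); last by lia.
move=> i i'; rewrite -vu' gMv dmxE [X in _ * X]dmxE; case: ifP => _.
  by apply: lge_le (lgeM pj (lgeM (@big_pow_ge _) (ga i i'))); lia.
by rewrite mul1r; apply: lge_le (lgeM (@small_pow_ge _) (ga i i')); lia.
Qed.

End QuadraticOrder.

(** * Rational rays *)

Lemma card_window (l a C : nat) :
  (#|[pred j : 'I_l | (a <= j + C) && (j <= a + C)]| <= C + C + 1)%N.
Proof.
set P := [pred j : 'I_l | _]; rewrite cardE -(size_map val).
rewrite -[leqRHS](size_iota (a - C)); apply: uniq_leq_size.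
  by rewrite map_inj_uniq ?enum_uniq //; exact: val_inj.
by move=> _ /mapP [j + ->]; rewrite mem_enum mem_iota inE /=; lia.
Qed.

Section RationalRays.
Variables (R : realType) (F : fieldType).
Hypothesis F01 : forall c : F, c = 0 \/ c = 1.
Variable f : laurent F.
Hypotheses (f1 : lge 1 f) (fE : f = lT F 1 * (1 + f ^+ 2)).
Variable nu : prime_poly F.
Hypothesis nuX : (nu : {poly F}) = 'X.
Local Notation x0 := (lat (g0 f)).

(** Multiplication by [eps^(2^k)] is a scalar modulo [Y^(2^k - 1)]. *)
Lemma unit_mx_sublattice (ab : 'cV[Knu nu]_2) n k E u : (n < 2 ^ k)%N ->
  sublattice ab n u -> sublattice ab n (unit_mx E k *m u).
Proof.
move=> nk uL; rewrite mulmxDl mul_scalar_mx -scalemxAl.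
apply: sublatticeD; first exact: sublatticeZ.
have -> : (2 ^ k - 1 = n + (2 ^ k - 1 - n))%N by lia.
by rewrite exprD -scalerA -{1}nuX; exact: sublattice_pow.
Qed.

Lemma x0_periodic : A_periodic x0.
Proof.
have [E gE] := companion_conj F01 fE (erefl x0).
apply: (@periodic_compact _ F01 2) => //.
apply: (@periodic_lattice _ F01 f f1 fE _ _ 1%:M (unit_mx E 0) (unit_mx E 0) 1 1).
- exact: (unit_mxE F01 fE 0 gE).
- exact: oner_neq0.
- by rewrite pmx1 mulmx1 scale1r.
- by rewrite mulmx1 mul1mx.
Qed.

Lemma sublattice_index (ab : 'cV[Knu nu]_2) n (W : 'M[{poly F}]_2) :
  (forall i, Onu (ab i 0)) -> (forall w, sublattice ab n w <-> exists u, w = W *m u) ->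
  'X ^+ n %| \det W.
Proof.
move=> abO WL; rewrite -nuX; apply: sublattice_det abO _ => j.
by apply/WL; exists (delta_mx j 0); rewrite colE.
Qed.

(** The measure of index [n] is built on the period [2^(k+1)], for the smallest [k]
    with [n < 2^k]. At the indices [n = 2^k - 1] all but a bounded number of the
    pieces of the orbit are near the cusp. *)
Lemma ray_measures g (ab : 'cV[Knu nu]_2) (r : nat -> Xinf F) : lat g = x0 ->
    (forall i, Onu (ab i 0)) -> rational_coords ab ->
    (forall n, lattice_in_class (lattice_image g (sublattice ab n)) (r n)) ->
  exists mu : nat -> probability (Xborel F) R,
    (forall n, orbit_measure (r n) (mu n)) /\
    forall h, exists C : nat, forall k,
      (mu (2 ^ k - 1)%N (~` shortX h) <= (C%:R / (2 * 2 ^ k)%:R)%:E)%E.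
Proof.
move=> gx abO /sublattice_rational [v v0 vL] rL.
have [E gE] := companion_conj F01 fE gx.
have /boolp.choice [C CP] := fun h => escape_window F01 f1 fE h gE v0.
have : forall n, exists m : probability (Xborel F) R, orbit_measure (r n) m /\
    forall k, n = (2 ^ k - 1)%N -> forall h,
    (m (~` shortX h) <= ((C h + C h + 1)%:R / (2 * 2 ^ k)%:R)%:E)%E.
  move=> n; have [g' [c [W [<- c0 gW WL]]]] := lattice_matrix (rL n).
  pose k := up_log 2 n.+1.
  have nk : (n < 2 ^ k)%N by exact: up_logP.
  have ME (w : 'cV[{poly F}]_2) : exists u : 'cV[{poly F}]_2, unit_mx E k *m (W *m w) = W *m u.
    apply: (WL _).1; apply: unit_mx_sublattice nk _; apply: (WL _).2.
    by exists w.
  have [U MU] : exists U, unit_mx E k *m W = W *m U.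
    have /boolp.choice [u uP] := fun j : 'I_2 => ME (delta_mx j 0).
    exists (\matrix_(i, j) u j i 0).
    apply/trmx_inj/row_matrixP => j; rewrite -!tr_col; congr trmx.
    rewrite !colE -!mulmxA uP; congr (_ *m _).
    by apply/matrixP => i i'; rewrite -colE !mxE ord1.
  have per := periodic_lattice F01 f1 fE (unit_mxE F01 fE k gE) c0 gW MU.
  have l0 : (0 < 2 * 2 ^ k)%N by rewrite muln_gt0 expn_gt0.
  have [m [mx mP]] := orbit_measure_ex R F01 l0 per; exists m; split=> // k' nk' h.
  have kk : k' = k.
    by rewrite /k nk' subn1 prednK ?expn_gt0 // up_expnK.
  rewrite {k'}kk in nk' *.
  apply: le_trans (mP _ [pred j : 'I_ _ | (2 ^ k <= j + C h) && (j <= 2 ^ k + C h)]%N _ _) _.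
  - exact: thick_measurable.
  - move=> j s /negP jP; apply; apply: (CP h k g' c W) => //.
    + by rewrite -nk'; exact: sublattice_index WL.
    + by have /WL [u vu] := vL n; exists u.
    + by have /WL [u ->] := vL n; exact: ME.
    + exact: one_unit1.
    + by move=> jC; apply: jP; rewrite inE /=; apply/andP.
  by rewrite lee_fin ler_pM2r ?invr_gt0 ?ltr0n // ler_nat; exact: card_window.
move=> /boolp.choice [mu muP]; exists mu; split=> [n|h]; first by case: (muP n).
by exists (C h + C h + 1)%N => k; case: (muP (2 ^ k - 1)%N) => _; apply.
Qed.

Lemma rational_end_zero xi : rational_end nu x0 xi ->
  Theta nu x0 xi (@mzero _ (Xborel F) R).
Proof.
move=> [g [ab [gx [abO _] abr [r [rL rx ->]]]]].
have [mu [muO muE]] := ray_measures gx abO abr rL.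
exists r, mu; split=> //.
  split; first by split=> //; exists 0%N, 0%N.
  rewrite -[RHS]gx; have [g' [c [W [<- c0 gW WL]]]] := lattice_matrix (rL 0%N).
  (* all vectors belong to the lattice of index 0, so [W] is invertible *)
  have /boolp.choice [u uP] : forall j : 'I_2, exists u : 'cV_2, delta_mx j 0 = W *m u.
    by move=> j; apply/WL; exact: sublattice0.
  have Wu : W \in unitmx.
    suff : W *m (\matrix_(i, j) u j i 0) = 1%:M by move=> /mulmx1_unit [].
    apply/trmx_inj/row_matrixP => j; rewrite -!tr_col; congr trmx.
    rewrite !colE -!mulmxA mul1mx [RHS]uP; congr (_ *m _).
    by apply/matrixP => i i'; rewrite -colE !mxE ord1.
  apply/esym/latP; exists c^-1, W; split; rewrite ?invr_eq0 //.
  by rewrite -gW scalerA mulVf // scale1r.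
apply: (@escape_weak_star _ _ mu (fun k => (2 ^ k - 1)%N)).
  by move=> k; have := ltn_expl k (isT : 1 < 2)%N; lia.
move=> h; have [C CP] := muE h.
apply: (@squeeze_cvgr _ _ _ _ (fun=> 0) (fun k => C%:R * k.+1%:R^-1)).
- apply: nearW => k; rewrite fine_ge0 //= -lee_fin fineK; last first.
    by rewrite fin_num_measure //; exact: thick_measurable.
  apply: le_trans (CP k) _; rewrite lee_fin ler_wpM2l // lef_pV2 ?posrE ?ltr0n ?muln_gt0 ?expn_gt0 //.
  by rewrite ler_nat; have := ltn_expl k (isT : 1 < 2)%N; lia.
- exact: cvg_cst.
- by rewrite -(mulr0 C%:R); apply: cvgMr; exact: cvg_harmonic.
Qed.

End RationalRays.

Theorem theorem2 (R : realType) :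
  exists (p k : nat) (F : finFieldType) (nu : prime_poly F) (x0 : Xinf F),
    [/\ prime p, (0 < k)%N, #|F| = (p ^ k)%N, A_periodic x0 &
      forall xi : set (nat -> Xinf F),
        hecke_boundary nu x0 xi -> rational_end nu x0 xi ->
        Theta nu x0 xi (@mzero _ (Xborel F) R)].
Proof.
have F01 (c : 'F_2) : c = 0 \/ c = 1.
  by case: c => -[|[|//]] ?; [left | right]; apply: val_inj.
have [f f1 fE] := small_root_ex 'F_2.
have X_irr : irreducible_poly ('X : {poly 'F_2}).
  by rewrite -['X]addr0 -polyC0; exact: irredp_XaddC.
exists 2%N, 1%N, 'F_2, (PrimePoly X_irr), (lat (g0 f)); split=> //.
- by rewrite card_Fp.
- exact: (x0_periodic F01 f1 fE).
by move=> xi _; apply: (@rational_end_zero R _ F01 f f1 fE).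
Qed.
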